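(* Let $n>3$, let $u\in C^4(\mathbb{R}^n)$ be a solution of $\Delta^2u=e^u$ in $\mathbb{R}^n$, let $x_0\in\mathbb{R}^n$, and let $E(\lambda,x_0,u)$ be the energy functional defined in the context. Then $E(\lambda,x_0,u)$ is a nondecreasing function of $\lambda>0$. Furthermore, $$\frac{dE(\lambda,x_0,u)}{d\lambda}\ \ge\ 2(n-3)\lambda^{2-n}\int_{\partial B(x_0,\lambda)}\left(\frac{\partial u}{\partial r}+\frac4\lambda\right)^2d\sigma.$$
   Context: $B(x_0,r)$ is the ball of radius $r$ centered at $x_0$ in $\mathbb{R}^n$, $\sigma$ is the surface measure on its boundary, and $\partial/\partial r$ is the radial derivative with respect to $x_0$. The energy is $$\begin{aligned}E(r,x_0,u)=\ &r^{4-n}\left[\int_{B(x_0,r)}\tfrac12|\Delta u|^2dx-\int_{B(x_0,r)}e^udx\right]-2r^{3-n}\int_{\partial B(x_0,r)}\left(\frac{\partial u}{\partial r}+\frac4r\right)^2d\sigma\\ &+\frac12r^3\frac d{dr}\left[r^{1-n}\int_{\partial B(x_0,r)}\left(\frac{\partial u}{\partial r}+\frac4r\right)^2d\sigma\right]-8(2-n)r^{1-n}\int_{\partial B(x_0,r)}(u+4\log r)d\sigma\\ &-4(2-n)r^{2-n}\int_{\partial B(x_0,r)}\left(\frac{\partial u}{\partial r}+\frac4r\right)d\sigma+\frac12\frac d{dr}\left[r^{4-n}\int_{\partial B(x_0,r)}\left(|\nabla u|^2-\left|\frac{\partial u}{\partial r}\right|^2\right)d\sigma\right]\\ &+\frac12r^{3-n}\int_{\partial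 B(x_0,r)}\left(|\nabla u|^2-\left|\frac{\partial u}{\partial r}\right|^2\right)d\sigma.\end{aligned}$$ *)

(* Defs.v *)
From HB Require Import structures.
From mathcomp Require Import all_boot all_order all_algebra.
From mathcomp Require Import all_classical all_reals all_analysis.
From mathcomp Require Import measurable_realfun.

Set Implicit Arguments.
Unset Strict Implicit.
Unset Printing Implicit Defensive.

Import Order.TTheory GRing.Theory Num.Theory.
Import numFieldNormedType.Exports.

Local Open Scope classical_set_scope.
Local Open Scope ring_scope.

(* R^n is 'rV[R]_n. The library norm `|x| on it is the sup norm, which serves
   only for the topology and for derivatives; balls and spheres below use the
   Euclidean norm enorm. *)

Section borel_row.
Context {R : realType} {n : nat}.

Let coor (i : 'I_n) (x : 'rV[R]_n) : R := x ord0 i.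

Fact row_display : measure_display.
Proof. exact: measure_tuple_display default_measure_display. Qed.

Let row_set0 : g_sigma_preimage coor set0.
Proof. exact: sigma_algebra0. Qed.

Let row_setC A : g_sigma_preimage coor A -> g_sigma_preimage coor (~` A).
Proof. exact: sigma_algebraC. Qed.

Let row_bigcup (F : (set 'rV[R]_n)^nat) :
  (forall i, g_sigma_preimage coor (F i)) ->
  g_sigma_preimage coor (\bigcup_i (F i)).
Proof. exact: sigma_algebra_bigcup. Qed.

(* The product sigma-algebra of the Borel sets of R, i.e. the Borel sets of
   R^n. *)
HB.instance Definition _ := @isMeasurable.Build row_display
  'rV[R]_n (g_sigma_preimage coor) row_set0 row_setC row_bigcup.

Lemma measurable_coor (i : 'I_n) :
  measurable_fun setT (fun x : 'rV[R]_n => x ord0 i : R).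
Proof.
move=> _ Y mY; rewrite setTI; apply: sub_sigma_algebra => /=.
rewrite -bigcup_seq/=; exists i => /=; first by rewrite mem_index_enum.
by exists Y => //; rewrite setTI.
Qed.

Lemma measurable_row d (T : measurableType d) (f : T -> 'rV[R]_n) :
  (forall i, measurable_fun setT (fun t => f t ord0 i)) ->
  measurable_fun setT f.
Proof.
move=> mf.
suff H : g_sigma_preimage (fun i => coor i \o f) `<=` measurable.
  move=> _ A mA; apply: H; rewrite g_sigma_preimage_comp.
  by exists A.
apply: smallest_sub; first exact: sigma_algebra_measurable.
move=> A; rewrite -bigcup_seq/= => -[i _ [B mB <-]].
exact: mf.
Qed.

End borel_row.

Section lebesgue_row.
Context {R : realType}.

Definition cons_row n (p : measurableTypeR R * 'rV[R]_n) : 'rV[R]_n.+1 :=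
  \row_i (if unlift ord0 i is Some j then p.2 ord0 j else p.1).

Definition uncons_row n (x : 'rV[R]_n.+1) : measurableTypeR R * 'rV[R]_n :=
  (x ord0 ord0, \row_j x ord0 (lift ord0 j)).

Lemma cons_row0 n (p : measurableTypeR R * 'rV[R]_n) :
  cons_row p ord0 ord0 = p.1.
Proof. by rewrite mxE unlift_none. Qed.

Lemma cons_rowS n (p : measurableTypeR R * 'rV[R]_n) j :
  cons_row p ord0 (lift ord0 j) = p.2 ord0 j.
Proof. by rewrite mxE liftK. Qed.

Lemma uncons_rowK n : cancel (@uncons_row n) (@cons_row n).
Proof.
move=> x; apply/rowP => i; case: (unliftP ord0 i) => [j|] ->.
  by rewrite cons_rowS mxE.
by rewrite cons_row0.
Qed.

Lemma measurable_cons_row n : measurable_fun setT (@cons_row n).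
Proof.
apply: measurable_row => i; case: (unliftP ord0 i) => [j|] ->.
  under eq_fun do rewrite cons_rowS.
  exact: (measurableT_comp (measurable_coor j) measurable_snd).
under eq_fun do rewrite cons_row0.
exact: measurable_fst.
Qed.

Lemma measurable_uncons_row n : measurable_fun setT (@uncons_row n).
Proof.
apply/measurable_fun_pairP; split; first exact: measurable_coor.
apply: measurable_row => i /=; under eq_fun do rewrite mxE.
exact: measurable_coor.
Qed.

Section step.
Context {n : nat} (mu : {sigma_finite_measure set 'rV[R]_n -> \bar R}).

Definition lebesgue_row_step : set 'rV[R]_n.+1 -> \bar R :=
  pushforward (@lebesgue_measure R \x mu)%E (@cons_row n).

HB.instance Definition _ := Measure.copy lebesgue_row_step
  (measure_function_pushforward__canonical__measure_function_Measure
     (@lebesgue_measure R \x mu)%E (@measurable_cons_row n)).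

Let step_sigma_finite : sigma_finite setT lebesgue_row_step.
Proof.
have /sigma_finiteP[F [TF ndF Foo]] := sigma_finiteT (@lebesgue_measure R).
have /sigma_finiteP[G [TG ndG Goo]] := sigma_finiteT mu.
exists (fun k => @uncons_row n @^-1` (F k `*` G k)).
  apply/esym/seteqP; split => // x _.
  have [k _ Fk] : (\bigcup_k F k) (uncons_row x).1 by rewrite -TF.
  have [l _ Gl] : (\bigcup_k G k) (uncons_row x).2 by rewrite -TG.
  exists (maxn k l) => //; split.
    by move: (uncons_row x).1 Fk; exact/subsetPset/ndF/leq_maxl.
  by move: (uncons_row x).2 Gl; exact/subsetPset/ndG/leq_maxr.
move=> k; have [mF Fk] := Foo k; have [mG Gk] := Goo k; split.
  rewrite -[X in measurable X]setTI; apply: measurable_uncons_row => //.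
  exact: measurableX.
rewrite /lebesgue_row_step /pushforward -comp_preimage.
rewrite (_ : _ \o _ = id) ?preimage_id.
  by rewrite product_measure1E// lte_mul_pinfty// ge0_fin_numE.
apply/funext => -[a y] /=; rewrite /uncons_row cons_row0; congr pair.
by apply/rowP => j; rewrite mxE cons_rowS.
Qed.

HB.instance Definition _ := Measure_isSigmaFinite.Build _ _ _
  lebesgue_row_step step_sigma_finite.

End step.

(* n-dimensional Lebesgue measure as the n-fold product of the Lebesgue measure
   of R; the point mass for n = 0. *)
Fixpoint lebesgue_row n : {sigma_finite_measure set 'rV[R]_n -> \bar R} :=
  match n with
  | 0 => dirac (0 : 'rV[R]_0)
  | n'.+1 => lebesgue_row_step (lebesgue_row n')
  end.

End lebesgue_row.
Arguments lebesgue_row {R} n.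

Section sphere.
Context {R : realType} {n : nat}.
Implicit Types (x v : 'rV[R]_n) (r : R).

Definition enorm v : R := Num.sqrt (\sum_(i < n) v ord0 i ^+ 2).

Definition eball (x0 : 'rV[R]_n) r : set 'rV[R]_n :=
  [set x | enorm (x - x0) < r].

Definition esphere (x0 : 'rV[R]_n) r : set 'rV[R]_n :=
  [set x | enorm (x - x0) = r].

Lemma measurable_enorm (x0 : 'rV[R]_n) :
  measurable_fun setT (fun x => enorm (x - x0)).
Proof.
rewrite (_ : (fun _ => _) = (@powR R ^~ 2^-1) \o
    (fun x => \sum_(i < n) (x ord0 i - x0 ord0 i) ^+ 2)).
  apply: measurableT_comp => //; apply: measurable_sum => i.
  apply: measurable_funX; apply: measurable_funB => //.
  exact: measurable_coor.
apply/funext => x /=; rewrite powR12_sqrt ?sumr_ge0// => [|i _].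
  by congr Num.sqrt; apply: eq_bigr => i _; rewrite !mxE.
exact: sqr_ge0.
Qed.

Lemma measurable_eball (x0 : 'rV[R]_n) r : measurable (eball x0 r).
Proof.
rewrite (_ : eball x0 r = (fun x => enorm (x - x0)) @^-1` `]-oo, r[%classic).
  by rewrite -[X in measurable X]setTI; exact: measurable_enorm.
by apply/seteqP; split => x; rewrite /eball/= in_itv.
Qed.

(* The radial projection of R^n \ {x0} onto the sphere of center x0 and
   radius r. *)
Definition sphere_proj (x0 : 'rV[R]_n) r x : 'rV[R]_n :=
  x0 + (r / enorm (x - x0)) *: (x - x0).

Lemma measurable_sphere_proj (x0 : 'rV[R]_n) r :
  measurable_fun setT (sphere_proj x0 r).
Proof.
apply: measurable_row => i.
under eq_fun do rewrite !mxE.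
apply: measurable_funD => //; apply: measurable_funM; last first.
  by apply: measurable_funB => //; exact: measurable_coor.
apply: measurable_funM => //.
under eq_fun do rewrite -(powR_inv1 (sqrtr_ge0 _)).
exact: (measurableT_comp (measurable_powR (-1)) (measurable_enorm x0)).
Qed.

(* Surface measure sigma of the sphere of center x0 and radius r > 0, extended
   by 0 to R^n: sigma(A) is n / r times the Lebesgue measure of the cone
   { x0 + t (y - x0) | y in A, 0 < t < 1 } over A, i.e. of the points of the
   ball whose radial projection is in A. In particular the total mass is
   n r^(n-1) |B(0,1)|, and dx = dsigma dr in polar coordinates. The absolute
   value keeps this a measure for r < 0, which is otherwise irrelevant. *)
Definition sphere_measure (x0 : 'rV[R]_n) r (A : set 'rV[R]_n) : \bar R :=
  (`|n%:R / r|%:E *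
   lebesgue_row n (sphere_proj x0 r @^-1` A `&` eball x0 r))%E.

Let restricted (x0 : 'rV[R]_n) r : {measure set 'rV[R]_n -> \bar R} :=
  mrestr (lebesgue_row n) (measurable_eball x0 r).

Let pushed (x0 : 'rV[R]_n) r : {measure set 'rV[R]_n -> \bar R} :=
  measure_function_pushforward__canonical__measure_function_Measure
    (restricted x0 r) (measurable_sphere_proj x0 r).

HB.instance Definition _ (x0 : 'rV[R]_n) r :=
  Measure.copy (sphere_measure x0 r) (mscale `|n%:R / r|%:nng (pushed x0 r)).

End sphere.

Section calculus.
Context {R : realType} {n : nat}.
Implicit Types (u f : 'rV[R]_n -> R) (x : 'rV[R]_n).

Definition partial (i : 'I_n) f x : R := 'D_(delta_mx ord0 i) f x.

Fixpoint isC (k : nat) f : Prop :=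
  continuous f /\
  match k with
  | 0 => True
  | k'.+1 => forall i, (forall x, derivable f x (delta_mx ord0 i)) /\
                       isC k' (partial i f)
  end.

Definition laplacian f x : R := \sum_(i < n) partial i (partial i f) x.

Definition grad_sq f x : R := \sum_(i < n) partial i f x ^+ 2.

(* Derivative at x in the direction of the unit vector (x - x0) / |x - x0|. *)
Definition radial (x0 : 'rV[R]_n) f x : R := 'D_((enorm (x - x0))^-1 *: (x - x0)) f x.

Definition energy (r : R) (x0 : 'rV[R]_n) u : R :=
  r ^ (4 - n%:Z) *
    (\int[lebesgue_row n]_(x in eball x0 r) (2^-1 * `|laplacian u x| ^+ 2)
     - \int[lebesgue_row n]_(x in eball x0 r) expR (u x))
  - 2 * r ^ (3 - n%:Z) *
    (\int[sphere_measure x0 r]_(x in esphere x0 r)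
       (radial x0 u x + 4 / r) ^+ 2)
  + 2^-1 * r ^+ 3 *
    derive1 (fun s : R => s ^ (1 - n%:Z) *
      (\int[sphere_measure x0 s]_(x in esphere x0 s)
         (radial x0 u x + 4 / s) ^+ 2)) r
  - 8 * (2 - n%:R) * r ^ (1 - n%:Z) *
    (\int[sphere_measure x0 r]_(x in esphere x0 r) (u x + 4 * ln r))
  - 4 * (2 - n%:R) * r ^ (2 - n%:Z) *
    (\int[sphere_measure x0 r]_(x in esphere x0 r) (radial x0 u x + 4 / r))
  + 2^-1 *
    derive1 (fun s : R => s ^ (4 - n%:Z) *
      (\int[sphere_measure x0 s]_(x in esphere x0 s)
         (grad_sq u x - `|radial x0 u x| ^+ 2))) r
  + 2^-1 * r ^ (3 - n%:Z) *
    (\int[sphere_measure x0 r]_(x in esphere x0 r)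
       (grad_sq u x - `|radial x0 u x| ^+ 2)).

End calculus.

(* Main.v *)
Require Import Defs.
From HB Require Import structures.
From mathcomp Require Import all_boot all_order all_algebra.
From mathcomp Require Import all_classical all_reals all_analysis.
From mathcomp Require Import measurable_realfun ring lra.

Set Implicit Arguments.
Unset Strict Implicit.
Unset Printing Implicit Defensive.

Import Order.TTheory GRing.Theory Num.Theory.
Import numFieldNormedType.Exports.

Local Open Scope classical_set_scope.
Local Open Scope ring_scope.

(* Write L f = (x - x0) . grad f, v = L u, phi = v + 4, and M(f) for the mean
   of f over the sphere of radius r (up to the constant |S^(n-1)|), so that
   r (M(f))' = M(L f).  Up to r ^ (4 - n) times the integral over the ball of
   h = |lap u|^2 / 2 - e^u, the energy is a combination of means M(f); in it
   the derivatives d/dr disappear in favour of L.  A Pohozaev argument turns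
   r M(h) and the ball integral of h into the boundary term
   M(r^2 (lap u L phi - phi L lap u)): the integrand (4 + L) h equals
   lap u lap phi - phi lap lap u because lap L = L lap + 2 lap, and Green's
   formula applies.  Splitting r^2 lap = L L + (n - 2) L + (spherical Laplacian)
   and integrating by parts on the sphere, everything cancels except
     r E' = 2 M((L v - phi)^2) + 2 M(r^2 |tangential gradient of v|^2)
            + 2 (n - 3) M(phi^2).
   Calculus on balls and spheres rests on two facts: the derivative of a ball
   integral in r is the sphere integral, and the divergence theorem. *)

(** * Lebesgue measure of R^n *)

(** The equation is invariant under [u(x) -> u(x0 + t (x - x0)) + 4 ln t], and [phi = L u + 4] is
    the derivative of this family at [t = 1]. This is the origin of the constant 4 in [du/dr + 4/r]
    and of the multiplier [phi] in the Pohozaev argument: the 4 in [phi] pairs with the 4 in [4 + L]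
    so that the exponential terms match. The obstacle is that the surface measure is given only as a
    cone measure, with no charts and no intrinsic calculus on the sphere. Tangential objects are
    therefore written in Cartesian partial derivatives, and facts about spheres are extracted from
    identities between ball integrals that hold for every radius: differentiating such an identity
    in the radius turns ball integrals into sphere integrals. The divergence theorem and the
    integration by parts for the spherical Laplacian are both obtained in this way. *)

Section transfer.
Context d d' (X : measurableType d) (Y : measurableType d') {R : realType}.
Variables (mu : {measure set X -> \bar R}) (nu : {measure set Y -> \bar R}).
Variables (T : X -> Y) (D : set X) (E : set Y) (k : R).
Hypothesis muT : forall g : Y -> \bar R, measurable_fun setT g ->
  (forall y, 0 <= g y)%E ->
  (\int[nu]_(y in E) g y = k%:E * \int[mu]_(x in D) g (T x))%E.

(** Pushforward formulas are available for nonnegative functions; positive and negative parts carry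
    them over to real ones. Integrability of [f \o T] keeps both parts finite, so that [k] factors
    out of the difference. Serves dilations ([k = c ^+ n]) and the surface measure ([k = n / r]). *)
Lemma Rintegral_transfer (f : Y -> R) : measurable D -> measurable_fun setT f ->
  mu.-integrable D (EFin \o (f \o T)) ->
  \int[nu]_(y in E) f y = k * \int[mu]_(x in D) f (T x).
Proof.
move=> mD mf intf.
have mEf : measurable_fun setT (EFin \o f) by exact/measurable_EFinP.
have p := integrable_pos_fin_num mD intf.
have m := integrable_neg_fin_num mD intf.
rewrite /Rintegral integralE [X in _ = _ * fine X]integralE.
have -> : (\int[nu]_(y in E) (EFin \o f)^\+ y =
    k%:E * \int[mu]_(x in D) (EFin \o (f \o T))^\+ x)%E.
  rewrite (muT (measurable_funepos mEf) (fun x => funepos_ge0 _ _)).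
  by congr (_ * _)%E; apply: eq_integral => x _; rewrite !funeposE.
have -> : (\int[nu]_(y in E) (EFin \o f)^\- y =
    k%:E * \int[mu]_(x in D) (EFin \o (f \o T))^\- x)%E.
  rewrite (muT (measurable_funeneg mEf) (fun x => funeneg_ge0 _ _)).
  by congr (_ * _)%E; apply: eq_integral => x _; rewrite !funenegE.
transitivity (fine (k%:E * (\int[mu]_(x in D) (EFin \o (f \o T))^\+ x
   - \int[mu]_(x in D) (EFin \o (f \o T))^\- x)))%E.
  by congr fine; rewrite [RHS]muleBr// fin_num_adde_defr.
by rewrite fineM// fin_numB p m.
Qed.

End transfer.

Section affine_change.
Context {R : realType}.
Local Notation leb := (@lebesgue_measure R).

Lemma measurable_affine (a c : R) :
  measurable_fun setT (fun t : measurableTypeR R => a + c * t : measurableTypeR R).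
Proof.
by apply: measurable_funD => //; apply: measurable_funM.
Qed.

Lemma affine_preimage_itv (a c x y : R) : 0 < c ->
  (fun t => a + c * t) @^-1` `]x, y]%classic =
  `](x - a) / c, (y - a) / c]%classic.
Proof.
move=> c0; apply/seteqP; split => t /=; rewrite !in_itv/=.
  by rewrite ltr_pdivrMr// ler_pdivlMr// ltrBlDl lerBrDl [t * c]mulrC.
by rewrite ltr_pdivrMr// ler_pdivlMr// ltrBlDl lerBrDl [t * c]mulrC.
Qed.

(** Uniqueness of Lebesgue measure: [c] times its image under [t -> a + c t] gives half-open
    intervals their length. *)
Lemma lebesgue_measure_affine (a : R) (c : R) (A : set (measurableTypeR R)) :
  0 < c -> measurable A ->
  leb ((fun t => a + c * t) @^-1` A) = (c^-1%:E * leb A)%E.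
Proof.
move=> c0 mA.
pose T := (fun t : measurableTypeR R => a + c * t : measurableTypeR R).
have mT : measurable_fun setT T by exact: measurable_affine.
pose P : {measure set (measurableTypeR R) -> \bar R} :=
  measure_function_pushforward__canonical__measure_function_Measure leb mT.
pose m : {measure set (measurableTypeR R) -> \bar R} :=
   mscale (NngNum (ltW c0)) P.
suff -> : leb A = m A.
  rewrite /m /= /mscale /= /P /= /pushforward muleA -EFinM mulVf ?mul1e//.
  by rewrite gt_eqF.
apply: lebesgue_measure_unique => // _ [[x y] _ <-].
rewrite /m /= /mscale /= /P /= /pushforward affine_preimage_itv//.
rewrite !lebesgue_measure_itv/= !lte_fin ltr_pM2r ?invr_gt0// ltrD2r.
case: ifP => _; last by rewrite mule0.
rewrite -!EFinB -EFinM; congr EFin.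
by field; rewrite gt_eqF.
Qed.

Lemma ge0_integral_affine (a c : R) (f : measurableTypeR R -> \bar R) :
  0 < c -> measurable_fun setT f -> (forall t, 0 <= f t)%E ->
  (\int[leb]_t f (a + c * t)%R = c^-1%:E * \int[leb]_t f t)%E.
Proof.
move=> c0 mf f0.
pose T := (fun t : measurableTypeR R => a + c * t : measurableTypeR R).
have mT : measurable_fun setT T by exact: measurable_affine.
have := @ge0_integral_pushforward _ _ _ _ R T mT leb setT f measurableT mf
  (fun y _ => f0 y).
rewrite preimage_setT => <-.
have ci : 0 <= c^-1 by rewrite invr_ge0 ltW.
rewrite (@eq_measure_integral _ _ _ setT (mscale (NngNum ci) leb)).
  by rewrite ge0_integral_mscale.
by move=> A mA _; exact: lebesgue_measure_affine.
Qed.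

Lemma measurable_affine_row n (a : 'rV[R]_n) (c : R) :
  measurable_fun setT (fun x : 'rV[R]_n => a + c *: x).
Proof.
apply: measurable_row => i; under eq_fun do rewrite !mxE.
apply: measurable_funD => //; apply: measurable_funM => //.
exact: measurable_coor.
Qed.

Lemma lebesgue_row_affine n (a : 'rV[R]_n) (c : R) (A : set 'rV[R]_n) :
  0 < c -> measurable A ->
  lebesgue_row n ((fun x => a + c *: x) @^-1` A) =
  ((c^-1 ^+ n)%:E * lebesgue_row n A)%E.
Proof.
move=> c0; elim: n => [|n IH] in a A *.
  move=> _; rewrite expr0 mul1e; congr (lebesgue_row 0 _).
  by apply/seteqP; split=> x /=; rewrite (_ : a + c *: x = x)//;
    apply/rowP => -[].
move=> mA.
have mcA : measurable (@cons_row R n @^-1` A).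
  by rewrite -[X in measurable X]setTI; exact: measurable_cons_row.
rewrite /= /lebesgue_row_step /pushforward /product_measure1 /=.
pose G := fun t : measurableTypeR R =>
  lebesgue_row n (xsection (@cons_row R n @^-1` A) t).
(* The section at [t] of the preimage is the affine preimage of the section at
   [a ord0 ord0 + c * t]: the induction hypothesis gives [n] factors [c^-1], and the change of
   variable in [t] the last one. *)
transitivity (\int[leb]_t ((c^-1 ^+ n)%:E * G (a ord0 ord0 + c * t)%R))%E.
  apply: eq_integral => t _; rewrite /G /=.
  rewrite -(IH (\row_j a ord0 (lift ord0 j))); last exact: measurable_xsection.
  congr (lebesgue_row n _); apply/seteqP; split => y /=;
    rewrite /xsection/= !inE/=;
    set u := (X in A X); set v := (X in _ -> A X);
    suff -> : u = v by [].
  - apply/rowP => i; rewrite /u /v; case: (unliftP ord0 i) => [j|] ->.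
      by rewrite !mxE liftK/= !mxE.
    by rewrite !mxE unlift_none.
  - apply/rowP => i; rewrite /u /v; case: (unliftP ord0 i) => [j|] ->.
      by rewrite !mxE liftK/= !mxE.
    by rewrite !mxE unlift_none.
have mG : measurable_fun setT G by exact: measurable_fun_xsection.
have ci : 0 <= c^-1 by rewrite invr_ge0 ltW.
rewrite ge0_integralZl//; last 2 first.
- apply: (measurableT_comp mG); exact: measurable_affine.
- by rewrite lee_fin exprn_ge0.
by rewrite ge0_integral_affine// muleA -EFinM exprSr.
Qed.

Lemma ge0_integral_affine_row n (a : 'rV[R]_n) (c : R) (D : set 'rV[R]_n)
    (f : 'rV[R]_n -> \bar R) :
  0 < c -> measurable D -> measurable_fun setT f -> (forall x, 0 <= f x)%E ->
  (\int[lebesgue_row n]_(x in (fun x => a + c *: x)%R @^-1` D) f (a + c *: x)%R =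
   (c^-1 ^+ n)%:E * \int[lebesgue_row n]_(x in D) f x)%E.
Proof.
move=> c0 mD mf f0.
pose T := (fun x : 'rV[R]_n => a + c *: x).
have mT : measurable_fun setT T by exact: measurable_affine_row.
have := @ge0_integral_pushforward _ _ _ _ R T mT (lebesgue_row n) D f mD
  (measurable_funTS mf) (fun y _ => f0 y).
move=> <-.
have ci : 0 <= c^-1 ^+ n by rewrite exprn_ge0// invr_ge0 ltW.
rewrite (@eq_measure_integral _ _ _ D (mscale (NngNum ci) (lebesgue_row n))).
  by rewrite ge0_integral_mscale//; exact: measurable_funTS.
by move=> A mA _; exact: lebesgue_row_affine.
Qed.

Lemma Rintegral_affine_row n (a : 'rV[R]_n) (c : R) (D : set 'rV[R]_n)
    (f : 'rV[R]_n -> R) :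
  0 < c -> measurable D -> measurable_fun setT f ->
  (lebesgue_row n).-integrable ((fun x => a + c *: x) @^-1` D)
    (fun x => (f (a + c *: x))%:E) ->
  \int[lebesgue_row n]_(x in D) f x = c ^+ n *
    \int[lebesgue_row n]_(x in (fun x => a + c *: x) @^-1` D) f (a + c *: x).
Proof.
move=> c0 mD mf intf.
have mTD : measurable ((fun x => a + c *: x) @^-1` D).
  by rewrite -[X in measurable X]setTI; exact: measurable_affine_row.
apply: (Rintegral_transfer _ mTD mf intf) => g mg g0.
rewrite ge0_integral_affine_row// muleA -EFinM -exprMn mulfV ?gt_eqF//.
by rewrite expr1n mul1e.
Qed.

End affine_change.

(** * Open sets and continuous functions on R^n are Borel *)

Section borel.
Context {R : realType} {n : nat}.
Implicit Types (U A : set 'rV[R]_n) (f : 'rV[R]_n -> R).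

Lemma measurable_box (q : 'rV[R]_n) (e : R) :
  measurable [set y : 'rV[R]_n | forall i, `|q ord0 i - y ord0 i| < e].
Proof.
rewrite (_ : mkset _ = \bigcap_(i in [set: 'I_n])
    ((fun y : 'rV[R]_n => `|q ord0 i - y ord0 i|) @^-1` `]-oo, e[%classic)).
  apply: fin_bigcap_measurable => // i _.
  rewrite -[X in measurable X]setTI.
  have : measurable_fun setT (fun y : 'rV[R]_n => `|q ord0 i - y ord0 i|).
    apply: measurableT_comp => //; apply: measurable_funB => //.
    exact: measurable_coor.
  by apply.
apply/seteqP; split => y /= h i; first by move=> _ /=; rewrite in_itv/=.
by have := h i I; rewrite /= in_itv/=.
Qed.

(** Links the topology to the product sigma-algebra: balls of the sup norm are boxes, and the
    countably many boxes with rational centre and half-side [1 / (k + 1)] suffice to fill an open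
    set. *)
Lemma open_measurable_row U : open U -> measurable U.
Proof.
move=> oU.
pose B (p : 'rV[rat]_n * nat) := [set y : 'rV[R]_n |
  forall i, `|(map_mx (@ratr R) p.1) ord0 i - y ord0 i| < p.2.+1%:R^-1].
have -> : U = \bigcup_p (if `[< B p `<=` U >] then B p else set0).
  apply/seteqP; split=> [x Ux|x [p _]]; last first.
    by case: asboolP => // + Bx; apply.
  have : nbhs x U by exact: open_nbhs_nbhs.
  move=> /nbhs_ballP[e /= e0 eU].
  (* Half of [e], because a point of the box is compared with [x] through the rational centre. *)
  have [m me] := ltr_add_invr (divr_gt0 e0 (ltr0Sn R 1)).
  rewrite add0r in me.
  have /choice[q Hq] : forall i, exists q : rat,
      `|ratr q - x ord0 i| < m.+1%:R^-1.
    move=> i.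
    have : x ord0 i - m.+1%:R^-1 < x ord0 i + m.+1%:R^-1.
      by rewrite ltrD2l gtrN// invr_gt0.
    move=> /rat_in_itvoo[q]; rewrite in_itv/= => /andP[q1 q2]; exists q.
    by rewrite ltr_distl q1 q2.
  exists (\row_i q i, m) => //.
  case: asboolP => [_ i /=|]; first by rewrite !mxE.
  case=> y /= By; apply: eU; split => // i j; rewrite ord1 /ball/=.
  rewrite distrC -(subrKA (ratr (q j))) (le_lt_trans (ler_normD _ _))//.
  rewrite (splitr e) ltrD//; last by rewrite (lt_trans (Hq j)).
  by rewrite distrC; have := By j; rewrite !mxE => /lt_trans; apply.
apply: countable_bigcupT_measurable => [|p]; first exact: countableP.
by case: ifP => // _; exact: measurable_box.
Qed.

Lemma measurable_continuous_row f : continuous f -> measurable_fun setT f.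
Proof.
move=> cf; move=> mT; apply: (measurability _ (RGenOInfty.measurableE R)) => // _ [_ [a ->] <-].
rewrite setTI; apply: open_measurable_row.
by apply: open_comp; [move=> x _; exact: cf|rewrite set_itvE; exact: open_gt].
Qed.

End borel.

Section enorm.
Context {R : realType} {n : nat}.
Implicit Types (x v : 'rV[R]_n) (r : R).

Lemma sqr_enorm v : enorm v ^+ 2 = \sum_(i < n) v ord0 i ^+ 2.
Proof. by rewrite sqr_sqrtr// sumr_ge0// => i _; rewrite sqr_ge0. Qed.

Lemma enorm_ge0 v : 0 <= enorm v.
Proof. exact: sqrtr_ge0. Qed.

Lemma enormZ c v : enorm (c *: v) = `|c| * enorm v.
Proof.
rewrite /enorm -sqrtr_sqr -sqrtrM ?sqr_ge0// mulr_sumr; congr Num.sqrt.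
by apply: eq_bigr => i _; rewrite mxE exprMn.
Qed.

Lemma coor_le_enorm v i : `|v ord0 i| <= enorm v.
Proof.
rewrite -sqrtr_sqr ler_wsqrtr// (bigD1 i)//= lerDl sumr_ge0// => j _.
exact: sqr_ge0.
Qed.

Lemma mx_norm_le_enorm v : `|v| <= enorm v.
Proof.
have [->|/mx_norm_neq0[[i j]]] := eqVneq `|v| 0; first exact: enorm_ge0.
by rewrite /= ord1 => vE; rewrite [leLHS]vE; exact: coor_le_enorm.
Qed.

(** [x0 - c *: x0 + c *: x] is the dilation of centre [x0] and ratio [c], in the form [a + c *: x]
    of the affine lemmas. *)
Lemma dilationB (x0 : 'rV[R]_n) c x : x0 - c *: x0 + c *: x - x0 = c *: (x - x0).
Proof. by apply/rowP => i; rewrite !mxE; ring. Qed.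

Lemma eball_dilation (x0 : 'rV[R]_n) r c : 0 < c ->
  (fun x => x0 - c *: x0 + c *: x) @^-1` eball x0 (c * r) = eball x0 r.
Proof.
move=> c0; rewrite /eball; apply/seteqP; split => x /=;
  by rewrite dilationB enormZ gtr0_norm ?ltr_pM2l.
Qed.

End enorm.

(** * Compact cubes and integrability on balls *)

Section ball_integral.
Context {R : realType} {n : nat}.
Implicit Types (x : 'rV[R]_n) (r : R) (f : 'rV[R]_n -> R).

(** Closed balls of the sup norm: as products of segments they are compact and of finite measure,
    hence a convenient container for Euclidean balls and spheres. *)
Definition cube (x0 : 'rV[R]_n) r : set 'rV[R]_n :=
  [set v | forall i, v ord0 i \in `[x0 ord0 i - r, x0 ord0 i + r]].

Lemma measurable_cube (x0 : 'rV[R]_n) r : measurable (cube x0 r).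
Proof.
rewrite (_ : cube _ _ = \bigcap_(i in [set: 'I_n])
    ((fun y : 'rV[R]_n => y ord0 i) @^-1`
      `[x0 ord0 i - r, x0 ord0 i + r]%classic)).
  apply: fin_bigcap_measurable => // i _.
  by rewrite -[X in measurable X]setTI; exact: measurable_coor.
by apply/seteqP; split => y /= h i; [move=> _|]; exact: h.
Qed.

Lemma compact_cube (x0 : 'rV[R]_n) r : compact (cube x0 r).
Proof.
apply: (@rV_compact R n (fun i => `[x0 ord0 i - r, x0 ord0 i + r]%classic)) => i.
exact: segment_compact.
Qed.

Lemma eball_cube (x0 : 'rV[R]_n) r : eball x0 r `<=` cube x0 r.
Proof.
move=> x /= xr i; rewrite in_itv/= -ler_distl.
have := le_trans (coor_le_enorm (x - x0) i) (ltW xr).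
by rewrite !mxE.
Qed.

Lemma bounded_on_cube (x0 : 'rV[R]_n) r f : continuous f ->
  exists2 M, 0 <= M & forall x, cube x0 r x -> `|f x| <= M.
Proof.
move=> cf.
have : bounded_set (f @` cube x0 r).
  apply: compact_bounded; apply: continuous_compact; last exact: compact_cube.
  by apply: continuous_subspaceT => x; exact: cf.
move=> [M [_ HM]]; exists (`|M| + 1); first by rewrite addr_ge0.
move=> x xr; apply: (HM (`|M| + 1)); last by exists x.
by rewrite (le_lt_trans (ler_norm _))// ltrDl.
Qed.

End ball_integral.

Lemma lebesgue_row_cube_fin {R : realType} n (x0 : 'rV[R]_n) r :
  (lebesgue_row n (cube x0 r) < +oo)%E.
Proof.
elim: n => [|n IH] in x0 *.
  by rewrite /= /dirac indicE ltry.
rewrite /= /lebesgue_row_step /pushforward.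
rewrite (_ : _ @^-1` _ = `[x0 ord0 ord0 - r, x0 ord0 ord0 + r]%classic `*`
  cube (\row_j x0 ord0 (lift ord0 j)) r).
  rewrite product_measure1E//=; last exact: measurable_cube.
  rewrite lebesgue_measure_itv/=; case: ifP => [|_]; last by rewrite mul0e ltry.
  rewrite lte_fin => /ltW rr.
  by rewrite lte_mul_pinfty// -EFinB ?fin_numE// lee_fin subr_ge0.
apply/seteqP; split => -[t y]/=.
  move=> h; split; first by have := h ord0; rewrite cons_row0.
  by move=> j; have := h (lift ord0 j); rewrite cons_rowS mxE.
move=> [h1 h2] i; case: (unliftP ord0 i) => [j|] ->.
  by rewrite cons_rowS; have := h2 j; rewrite mxE.
by rewrite cons_row0.
Qed.

Section ball_integral.
Context {R : realType} {n : nat}.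
Implicit Types (x : 'rV[R]_n) (r : R) (f g : 'rV[R]_n -> R).

Lemma lebesgue_row_eball_fin (x0 : 'rV[R]_n) r :
  (lebesgue_row n (eball x0 r) < +oo)%E.
Proof.
apply: le_lt_trans (lebesgue_row_cube_fin x0 r).
apply: le_measure; rewrite ?inE; [exact: measurable_eball|exact: measurable_cube|].
exact: eball_cube.
Qed.

Lemma integrable_eball (x0 : 'rV[R]_n) r f M : measurable_fun setT f ->
  (forall x, eball x0 r x -> `|f x| <= M) ->
  (lebesgue_row n).-integrable (eball x0 r) (EFin \o f).
Proof.
move=> mf fM; apply: measurable_bounded_integrable.
- exact: measurable_eball.
- exact: lebesgue_row_eball_fin.
- exact: measurable_funTS.
- exists M; split; first by rewrite num_real.
  by move=> N MN x /= xr; rewrite (le_trans (fM _ xr))// ltW.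
Qed.

Lemma continuous_integrable_eball (x0 : 'rV[R]_n) r f : continuous f ->
  (lebesgue_row n).-integrable (eball x0 r) (EFin \o f).
Proof.
move=> cf; have [M _ HM] := bounded_on_cube x0 r cf.
apply: (@integrable_eball _ _ _ M) => [|x /eball_cube/HM//].
exact: measurable_continuous_row.
Qed.

(** Only [x] is confined to the cube, so the estimate also covers nearby points [y] outside it. The
    near-covering form of compactness makes [d] uniform in [x]. *)
Lemma unif_continuous_cube (x0 : 'rV[R]_n) r f (e : R) : continuous f -> 0 < e ->
  exists2 d, 0 < d & forall x y, cube x0 r x -> `|x - y| < d -> `|f x - f y| < e.
Proof.
move=> cf e0.
have := @compact_cube R n x0 r; rewrite compact_near_coveringP => /(_ R (nbhs (0:R)^'+)
  (fun d x => forall y, `|x - y| < d -> `|f x - f y| < e)).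
move=> H; have : \forall d \near (0:R)^'+, cube x0 r `<=`
    (fun x => forall y, `|x - y| < d -> `|f x - f y| < e).
  apply: H => x _.
  have /cvgrPdist_lt/(_ _ (divr_gt0 e0 (ltr0Sn R 1))) := cf x.
  move=> /nbhs_ballP[d /= d0 Hd].
  exists (ball x (d / 2), `]-oo, d / 2[%classic) => /=.
    split; first by apply: nbhsx_ballx; rewrite divr_gt0.
    by apply: nbhs_right_lt; rewrite divr_gt0.
  move=> [x' d'] [/= xx']; rewrite in_itv/= => dd' y x'y.
  have Hx' : `|f x - f x'| < e / 2.
    by apply: Hd; rewrite -ball_normE/= in xx' *; rewrite (lt_trans xx')// ltr_pdivrMr// ltr_pMr// ltr1n.
  have Hy : `|f x - f y| < e / 2.
    apply: Hd; rewrite -ball_normE/= in xx' *.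
    rewrite -(subrKA x') (splitr d) (le_lt_trans (ler_normD _ _))// ltrD//.
    by rewrite (lt_trans x'y).
  rewrite -(subrKA (f x)) (splitr e) (le_lt_trans (ler_normD _ _))// ltrD//.
  by rewrite distrC.
move=> Hd; have [d [d0 dH]] : exists d : R, 0 < d /\ cube x0 r `<=`
    (fun x => forall y, `|x - y| < d -> `|f x - f y| < e).
  have : \forall d \near (0:R)^'+, 0 < d /\ cube x0 r `<=`
    (fun x => forall y, `|x - y| < d -> `|f x - f y| < e).
    by near=> d; split; [near: d; exact: nbhs_right_gt|near: d].
  by move=> /filter_ex.
by exists d => // x y xr; exact: dH.
Unshelve. all: by end_near. Qed.

End ball_integral.

(** * Polar coordinates *)

Section derive_eps.
Context {R : realType}.

(** First-order expansion instead of a limit of quotients: free of division, it includes [s = r] and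
    combines directly with estimates on increments. *)
Lemma is_derive1_epsP (f : R -> R) (r d : R) :
  is_derive r 1 f d <-> forall e, 0 < e ->
    \forall s \near r, `|f s - f r - d * (s - r)| <= e * `|s - r|.
Proof.
split=> [[df fE] e e0|H].
  move: df; rewrite /derivable => /cvg_ex[l Hl].
  have ld : l = d by rewrite -fE /derive; apply/esym/cvg_lim.
  move: Hl; rewrite ld => /cvgrPdist_le/(_ e e0).
  move=> /nbhs_ballP[/= del del0 Hdel]; apply/nbhs_ballP; exists del => //.
  move=> s rs; have [->|sr] := eqVneq s r.
    by rewrite !subrr mulr0 subrr normr0 mulr0.
  rewrite /ball/= distrC in rs.
  have := Hdel (s - r); rewrite /ball/= sub0r normrN subr_eq0 => /(_ rs sr); rewrite /GRing.scale/= mulr1 subrK.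
  rewrite distrC => h.
  have -> : f s - f r - d * (s - r) =
      ((s - r)^-1 * (f s - f r) - d) * (s - r) by field; rewrite subr_eq0.
  by rewrite normrM ler_wpM2r.
have : (fun h => h^-1 *: (f (h *: 1 + r) - f r)) @ 0^' --> d.
  apply/cvgrPdist_le => e e0; have := H e e0.
  move=> /nbhs_ballP[/= del del0 Hdel]; apply/nbhs_ballP; exists del => //.
  move=> h; rewrite /ball/= sub0r normrN => hd h0.
  have /= := Hdel (h + r); rewrite /ball/= opprD addrCA subrr addr0 normrN.
  move=> /(_ hd); rewrite addrK /GRing.scale/= mulr1 => h2.
  rewrite distrC -(ler_pM2r (_ : 0 < `|h|)) ?normr_gt0// -normrM.
  by rewrite mulrBl mulrAC mulVf// mul1r.
by move=> h; split; [apply/cvg_ex; exists d|exact/cvg_lim].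
Qed.

Lemma is_derive_addf (f g : R -> R) (r df dg : R) : is_derive r 1 f df ->
  is_derive r 1 g dg -> is_derive r 1 (fun s => f s + g s) (df + dg).
Proof. by move=> hf hg; exact: is_deriveD. Qed.

Lemma is_derive_mulf (f g : R -> R) (r df dg : R) : is_derive r 1 f df ->
  is_derive r 1 g dg -> is_derive r 1 (fun s => f s * g s) (f r * dg + df * g r).
Proof. by move=> hf hg; rewrite [df * _]mulrC; exact: is_deriveM. Qed.

Lemma is_derive_scalef (f : R -> R) (r df c : R) : is_derive r 1 f df ->
  is_derive r 1 (fun s => c * f s) (c * df).
Proof. by move=> hf; exact: is_deriveZ. Qed.

Lemma is_derive_expn k (r : R) :
  is_derive r 1 (fun s : R => s ^+ k) (k%:R * r ^+ k.-1).
Proof.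
by split; [exact: exprn_derivable|rewrite exp_derive /GRing.scale/= mulr1].
Qed.

End derive_eps.

Section polar.
Context {R : realType} {n : nat}.
Implicit Types (x : 'rV[R]_n) (r s : R) (f g : 'rV[R]_n -> R).
Local Notation mu := (@lebesgue_row R n).
Variable x0 : 'rV[R]_n.

Definition ball_int f r : R := \int[lebesgue_row n]_(x in eball x0 r) f x.

Definition sphere_int f r : R :=
  \int[sphere_measure x0 r]_(x in esphere x0 r) f x.

Lemma measurable_esphere r : measurable (esphere x0 r).
Proof.
rewrite (_ : esphere x0 r = (fun x => enorm (x - x0)) @^-1` [set r])//.
by rewrite -[X in measurable X]setTI; exact: measurable_enorm.
Qed.

Lemma ge0_integral_sphere_measure r (g : 'rV[R]_n -> \bar R) :
  measurable_fun setT g -> (forall x, 0 <= g x)%E ->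
  (\int[sphere_measure x0 r]_x g x =
   `|n%:R / r|%:E * \int[mu]_(x in eball x0 r) g (sphere_proj x0 r x))%E.
Proof.
move=> mg g0.
pose rs : {measure set 'rV[R]_n -> \bar R} := mrestr mu (measurable_eball x0 r).
have mp := measurable_sphere_proj x0 r.
rewrite (@eq_measure_integral _ _ _ setT (mscale `|n%:R / r|%:nng
  (measure_function_pushforward__canonical__measure_function_Measure rs mp)));
  last by [].
rewrite ge0_integral_mscale//; congr (_ * _)%E.
rewrite (@ge0_integral_pushforward _ _ _ _ R _ mp rs setT)// preimage_setT.
have mgp : measurable_fun setT (g \o sphere_proj x0 r) by exact: measurableT_comp.
have mN : measurable (~` eball x0 r) by apply: measurableC; exact: measurable_eball.
(* [rs] does not charge the complement of the ball, so the integral over the whole space reduces to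
   the ball. *)
have N0 : rs (~` eball x0 r) = 0%E by rewrite /rs /= /mrestr setICl measure0.
rewrite (@ge0_negligible_integral _ _ _ rs setT (~` eball x0 r))//.
  rewrite setTD setCK; apply: eq_measure_integral => A mA AB.
  by rewrite /rs /= /mrestr setIidl.
by move=> x _; exact: g0.
Qed.

(* Constant along rays from [x0], with the junk value 0 at [x0]. *)
Definition radial_ext f r x : R := (f \_ (esphere x0 r)) (sphere_proj x0 r x).

Lemma sphere_projE r x : enorm (sphere_proj x0 r x - x0) =
  `|r / enorm (x - x0)| * enorm (x - x0).
Proof. by rewrite /sphere_proj addrAC subrr add0r enormZ. Qed.

Lemma measurable_radial_ext f r : measurable_fun setT f ->
  measurable_fun setT (radial_ext f r).
Proof.
move=> mf; have : measurable_fun setT (f \_ (esphere x0 r)).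
  apply/(measurable_restrictT _ (measurable_esphere r)).
  exact: measurable_funTS.
by move=> m; apply: (measurableT_comp m); exact: measurable_sphere_proj.
Qed.

Lemma radial_ext_bounded f r M : 0 <= M ->
  (forall x, esphere x0 r x -> `|f x| <= M) -> forall x, `|radial_ext f r x| <= M.
Proof.
move=> M0 HM x; rewrite /radial_ext /patch; case: ifPn => [|_].
  by rewrite inE; exact: HM.
by rewrite normr0.
Qed.

Lemma esphere_cube r : esphere x0 r `<=` cube x0 r.
Proof.
move=> x /= xr i; rewrite in_itv/= -ler_distl.
by have := coor_le_enorm (x - x0) i; rewrite xr !mxE.
Qed.

Lemma radial_ext_integrable f r s : continuous f ->
  mu.-integrable (eball x0 s) (EFin \o radial_ext f r).
Proof.
move=> cf; have [M M0 HM] := bounded_on_cube x0 r cf.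
apply: (@integrable_eball _ _ _ _ _ M).
  by apply: measurable_radial_ext; exact: measurable_continuous_row.
move=> x _; apply: radial_ext_bounded => // y /esphere_cube; exact: HM.
Qed.

Lemma sphere_intE f r : continuous f -> 0 < r ->
  sphere_int f r = n%:R / r * ball_int (radial_ext f r) r.
Proof.
move=> cf r0; rewrite /sphere_int Rintegral_mkcond.
have mf : measurable_fun setT (f \_ (esphere x0 r)).
  apply/(measurable_restrictT _ (measurable_esphere r)).
  by apply: measurable_funTS; exact: measurable_continuous_row.
rewrite -[n%:R / r]ger0_norm ?divr_ge0 ?(ltW r0)//.
apply: (@Rintegral_transfer _ _ _ _ _ mu _ (sphere_proj x0 r)) => //.
- by move=> g mg g0; exact: ge0_integral_sphere_measure.
- exact: measurable_eball.
- exact: radial_ext_integrable.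
Qed.

Lemma sphere_proj_dilation r c x : 0 < c ->
  sphere_proj x0 r (x0 - c *: x0 + c *: x) = sphere_proj x0 r x.
Proof.
move=> c0; rewrite /sphere_proj dilationB enormZ gtr0_norm// scalerA.
(* At the centre, inversion of 0 gives 0 and both sides equal [x0]. *)
have [->|xx0] := eqVneq (enorm (x - x0)) 0; first by rewrite mulr0 invr0 !mulr0 mul0r.
by congr (_ + _ *: _); field; rewrite xx0 gt_eqF.
Qed.

Lemma radial_ext_dilation f r c x : 0 < c ->
  radial_ext f r (x0 - c *: x0 + c *: x) = radial_ext f r x.
Proof. by move=> c0; rewrite /radial_ext sphere_proj_dilation. Qed.

Lemma ball_int_homogeneous g r c M : measurable_fun setT g ->
  (forall x, `|g x| <= M) ->
  (forall x c, 0 < c -> g (x0 - c *: x0 + c *: x) = g x) -> 0 < c ->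
  ball_int g (c * r) = c ^+ n * ball_int g r.
Proof.
move=> mg gM gh c0; rewrite /ball_int (@Rintegral_affine_row _ _ (x0 - c *: x0) c)//.
- rewrite eball_dilation//; congr (_ * _).
  by apply: eq_Rintegral => x _; rewrite gh.
- exact: measurable_eball.
- rewrite eball_dilation//; under eq_fun do rewrite gh//.
  by apply: (integrable_eball (M := M)).
Qed.

(** The left-hand side is an integral over a shell. Its volume is kept as a difference of ball
    integrals of 1, to which [ball_int_homogeneous] applies. *)
Lemma ball_int_sub_le g a b e : a <= b -> 0 <= e ->
  mu.-integrable (eball x0 b) (EFin \o g) ->
  (forall x, a <= enorm (x - x0) < b -> `|g x| <= e) ->
  `|ball_int g b - ball_int g a| <=
    e * (ball_int (cst 1) b - ball_int (cst 1) a).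
Proof.
move=> ab e0 ig ge.
have mA := measurable_eball x0 a; have mB := measurable_eball x0 b.
have mD : measurable (eball x0 b `\` eball x0 a) by exact: measurableD.
have AB : eball x0 a `<=` eball x0 b.
  by move=> x xa; exact: lt_le_trans xa ab.
have BE : eball x0 b = eball x0 a `|` (eball x0 b `\` eball x0 a).
  by rewrite setDUK.
have split_int h : mu.-integrable (eball x0 b) (EFin \o h) ->
    ball_int h b - ball_int h a = \int[mu]_(x in eball x0 b `\` eball x0 a) h x.
  move=> ih; rewrite /ball_int {1}BE Rintegral_setU//; last 2 first.
  - by rewrite -BE.
  - by apply/disj_setPS => x [/= xa []].
  by rewrite addrAC subrr add0r.
have i1 : mu.-integrable (eball x0 b) (EFin \o cst 1).
  by apply: continuous_integrable_eball; exact: cst_continuous.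
have igD : mu.-integrable (eball x0 b `\` eball x0 a) (EFin \o g).
  exact: integrableS ig.
have i1D : mu.-integrable (eball x0 b `\` eball x0 a) (EFin \o cst 1).
  exact: integrableS i1.
rewrite !split_int// (le_trans (le_normr_Rintegral _ _))// -RintegralZl//.
apply: le_Rintegral => //.
- exact: (integrable_norm igD).
- exact: (integrableZl mD e i1D).
- move=> x [/= xb] /negP; rewrite -leNgt => ax.
  by rewrite mulr1 ge// ax.
Qed.

(** Radial projection moves [x] by exactly the Euclidean distance [|enorm (x - x0) - r|], which
    dominates the sup norm used in the hypothesis. *)
Lemma radial_ext_near f r x e : 0 < r -> 0 < enorm (x - x0) -> 
  (forall y, `|x - y| <= `|enorm (x - x0) - r| -> `|f x - f y| <= e) ->
  `|f x - radial_ext f r x| <= e.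
Proof.
move=> r0 x_gt0 H.
have pE : enorm (sphere_proj x0 r x - x0) = r.
  by rewrite sphere_projE ger0_norm ?divr_ge0 ?(ltW r0) ?(ltW x_gt0)// divfK ?gt_eqF.
rewrite /radial_ext patchT ?inE//; apply: H.
rewrite (le_trans (mx_norm_le_enorm _))//.
have -> : x - sphere_proj x0 r x = ((enorm (x - x0) - r) / enorm (x - x0)) *: (x - x0).
  apply/rowP => i; rewrite !mxE; field; by rewrite gt_eqF.
by rewrite enormZ normrM normfV (gtr0_norm x_gt0) divfK// gt_eqF.
Qed.

(* On a thin shell around the sphere [f] is close to its radial extension, whose
   ball integral is homogeneous of degree [n] in the radius. *)
Theorem is_derive_ball_int f r : continuous f -> 0 < r ->
  is_derive r 1 (ball_int f) (sphere_int f r).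
Proof.
move=> cf r0; apply/is_derive1_epsP => e e0.
rewrite sphere_intE//.
set F := radial_ext f r; set IF := ball_int F r.
pose V := ball_int (cst 1).
have rn0 : r != 0 by rewrite gt_eqF.
have mf : measurable_fun setT f by exact: measurable_continuous_row.
have [MF MF0 HMF] := bounded_on_cube x0 r cf.
have FE s : 0 < s -> ball_int F s = (s / r) ^+ n * IF.
  move=> s0; rewrite -(@ball_int_homogeneous F r (s / r) MF) ?divfK//.
  - exact: measurable_radial_ext.
  - by move=> x; apply: radial_ext_bounded => // y /esphere_cube; exact: HMF.
  - by move=> x c c0; exact: radial_ext_dilation.
  - by rewrite divr_gt0.
have VE s : 0 < s -> V s = (s / r) ^+ n * V r.
  move=> s0; rewrite -(@ball_int_homogeneous (cst 1) r (s / r) 1) ?divfK//.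
  - by move=> x; rewrite normr1.
  - by rewrite divr_gt0.
have V0 : 0 <= V r by apply: Rintegral_ge0.
have dpow : is_derive r 1 (fun s => (s / r) ^+ n) (n%:R / r).
  have -> : (fun s => (s / r) ^+ n) = (fun s => r^-1 ^+ n * s ^+ n).
    by apply/funext => s; rewrite exprMn mulrC.
  have := is_derive_scalef (r^-1 ^+ n) (is_derive_expn n r).
  suff -> : n%:R / r = r^-1 ^+ n * (n%:R * r ^+ n.-1) by [].
  case: (n) => [|m]; first by rewrite !mul0r mulr0.
  rewrite mulrCA exprSr mulrAC -exprMn mulVf// expr1n mul1r//.
have /is_derive1_epsP dp := dpow.
(* [C * V r] bounds the difference quotients of the volume [V] near [r]: derivative [n / r] of
   [(s / r) ^+ n], plus a slack of 1. Then [e1] makes [e1 * (C * V r)] at most [e / 2]; the 1 in its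
   denominator excludes division by zero. *)
pose C := n%:R / r + 1.
have C0 : 0 < C by rewrite ltr_wpDl// divr_ge0// ltW.
pose e1 := e / 2 / (C * V r + 1).
have den : 0 < C * V r + 1 by rewrite ltr_wpDl// mulr_ge0// ltW.
have IF1 : 0 < `|IF| + 1 by rewrite ltr_wpDl.
have e10 : 0 < e1 by rewrite !divr_gt0.
(* This cube contains the balls of all radii up to [2 * r], hence those of radius [s] close to
   [r]. *)
have [d d0 Hd] := unif_continuous_cube x0 (2 * r) cf e10.
have hE s : ball_int (fun x => f x - F x) s = ball_int f s - ball_int F s.
  rewrite /ball_int RintegralB//; first exact: measurable_eball.
    exact: continuous_integrable_eball.
  exact: radial_ext_integrable.
have hint s : mu.-integrable (eball x0 s) (EFin \o (fun x => f x - F x)).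
  have m := measurable_eball x0 s.
  exact: (integrableB m (continuous_integrable_eball _ _ cf) (radial_ext_integrable _ _ cf)).
have hle a b : 0 < a -> a <= b -> b <= 2 * r -> r - d < a -> b < r + d ->
    `|ball_int (fun x => f x - F x) b - ball_int (fun x => f x - F x) a| <=
    e1 * (V b - V a).
  move=> a0 ab br ra rb; apply: ball_int_sub_le => //; first exact: ltW.
  move=> x /andP[xa xb]; apply: radial_ext_near => //.
    exact: lt_le_trans xa.
  move=> y xy; apply/ltW; apply: Hd.
    by apply: eball_cube; exact: lt_le_trans br.
  apply: le_lt_trans xy _; rewrite ltr_norml; apply/andP; split; lra.
near=> s.
have sr : `|s - r| < r by near: s; apply/nbhs_ballP; exists r => // s; rewrite /ball/= distrC.
have sd : `|s - r| < d by near: s; apply/nbhs_ballP; exists d => // s; rewrite /ball/= distrC.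
have H1 : `|(s / r) ^+ n - (r / r) ^+ n - n%:R / r * (s - r)| <= 1 * `|s - r|.
  by near: s; apply: dp.
have H2 : `|(s / r) ^+ n - (r / r) ^+ n - n%:R / r * (s - r)| <=
    (e / 2 / (`|IF| + 1)) * `|s - r|.
  by near: s; apply: dp; rewrite !divr_gt0// ltr_wpDl.
rewrite divff// expr1n in H1 H2.
have s0 : 0 < s by move: sr; rewrite ltr_norml => /andP[]; lra.
have Vsr : `|V s - V r| <= C * V r * `|s - r|.
  rewrite VE// -{2}[V r]mul1r -mulrBl normrM (ger0_norm V0) mulrAC ler_wpM2r//.
  rewrite -(subrK (n%:R / r * (s - r)) (_ - _)) (le_trans (ler_normD _ _))//.
  rewrite /C mulrDl addrC lerD// normrM ger0_norm// divr_ge0// ltW//.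
have hsr : `|ball_int (fun x => f x - F x) s - ball_int (fun x => f x - F x) r| <=
    e1 * `|V s - V r|.
  move: sr sd; rewrite !ltr_norml => /andP[sr1 sr2] /andP[sd1 sd2].
  have [rs|/ltW rs] := leP r s.
    rewrite (le_trans (hle r s _ _ _ _ _))//; try lra.
    by rewrite ler_pM2l// ler_norm.
  rewrite distrC [in leRHS]distrC (le_trans (hle s r _ _ _ _ _))//; try lra.
  by rewrite ler_pM2l// ler_norm.
(* Splitting [f] as [(f - F) + F]: the shell estimate controls the first part, and the ball integral
   of [F] is exactly [(s / r) ^+ n * IF]. *)
have -> : ball_int f s - ball_int f r - n%:R / r * IF * (s - r) =
   (ball_int (fun x => f x - F x) s - ball_int (fun x => f x - F x) r) +
   IF * ((s / r) ^+ n - 1 - n%:R / r * (s - r)).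
  by rewrite !hE (FE s)// -/IF; ring.
rewrite (le_trans (ler_normD _ _))// (splitr e) mulrDl lerD//.
  rewrite (le_trans hsr)//.
  rewrite (le_trans (ler_wpM2l (ltW e10) Vsr))// mulrA ler_wpM2r//.
  by rewrite -[e / 2](divfK (lt0r_neq0 den)) -/e1 ler_pM2l// lerDl.
rewrite normrM (le_trans (ler_wpM2l (normr_ge0 _) H2))// mulrA ler_wpM2r//.
rewrite mulrC -[leRHS](divfK (lt0r_neq0 IF1)) ler_pM2l ?divr_gt0//.
by rewrite lerDl.
Unshelve. all: by end_near. Qed.

End polar.

(** * Functions with continuous partial derivatives *)

Section partials.
Context {R : realType} {n : nat}.
Implicit Types (x y v w : 'rV[R]_n) (f g : 'rV[R]_n -> R) (i j : 'I_n).
Local Notation ev i := (delta_mx ord0 i : 'rV[R]_n).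

Lemma normZ_delta (s : R) i : `|s *: ev i| <= `|s|.
Proof.
rewrite normrZ -[leRHS]mulr1 ler_wpM2l// (le_trans (mx_norm_le_enorm _))//.
rewrite /enorm (bigD1 i)//= big1 ?addr0 ?mxE ?eqxx ?expr1n ?sqrtr1//.
by move=> j ji; rewrite mxE (negbTE ji) andbF expr0n.
Qed.

Lemma isC_continuous k f : isC k f -> continuous f.
Proof. by case: k => [|k] []. Qed.

Lemma isC_derivable k f i x : isC k.+1 f -> derivable f x (ev i).
Proof. by move=> [_ /(_ i)[]]. Qed.

Lemma isC_partial k f i : isC k.+1 f -> isC k (partial i f).
Proof. by move=> [_ /(_ i)[]]. Qed.

Lemma isCS k f : isC k.+1 f -> isC k f.
Proof.
elim: k f => [|k IH] f; first by case.
move=> [cf H]; split => // i; have [df Cf] := H i; split => //; exact: IH.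
Qed.

Lemma isC_le k l f : (k <= l)%N -> isC l f -> isC k f.
Proof.
move=> /subnKC <-; elim: (l - k)%N => [|m IH]; first by rewrite addn0.
by rewrite addnS => /isCS/IH.
Qed.

Lemma is_derive_line f v x (t : R) : derivable f (x + t *: v) v ->
  is_derive t 1 (fun s : R => f (x + s *: v)) ('D_v f (x + t *: v)).
Proof.
have E : (fun h : R => h^-1 *: (f (x + (h *: 1 + t) *: v) - f (x + t *: v))) =
  (fun h : R => h^-1 *: (f (h *: v + (x + t *: v)) - f (x + t *: v))).
  apply/funext => h; congr (_ *: (f _ - _)).
  by rewrite [h%:A]mulr1 scalerDl addrCA.
by move=> df; split; rewrite /derivable /derive E.
Qed.

Lemma line_MVT f v x (t : R) : (forall y, derivable f y v) ->
  exists2 s : R, `|s| <= `|t| & f (x + t *: v) - f x = t * 'D_v f (x + s *: v).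
Proof.
move=> df; pose F s := f (x + s *: v).
have dF (s : R) : is_derive s 1 F ('D_v f (x + s *: v)) by exact: is_derive_line.
have cF a b : {within `[a, b], continuous F}.
  apply: continuous_subspaceT => s; apply: differentiable_continuous.
  by apply/derivable1_diffP; have [] := dF s.
have F0 : F 0 = f x by rewrite /F scale0r addr0.
have [t0|/ltW t0] := leP 0 t.
  have [s] := MVT_segment t0 (fun s _ => dF s) (cF _ _).
  rewrite in_itv/= => /andP[s0 st]; rewrite subr0 F0 mulrC => E.
  by exists s; rewrite ?ger0_norm.
have [s] := MVT_segment t0 (fun s _ => dF s) (cF _ _).
rewrite in_itv/= => /andP[s0 st]; rewrite sub0r F0 mulrC mulNr => E.
by exists s; [rewrite !ler0_norm// lerN2|rewrite -[RHS]opprK -E opprB].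
Qed.

Lemma partial_MVT i f x (t : R) : isC 1 f ->
  exists2 s : R, `|s| <= `|t| &
    f (x + t *: ev i) - f x = t * partial i f (x + s *: ev i).
Proof. by move=> Cf; apply: line_MVT => y; exact: isC_derivable Cf. Qed.

(** Restriction to a line, so that the chain rule of one real variable applies to directional
    derivatives. *)
Lemma is_derive_lineP f x v (d : R) :
  is_derive x v f d <-> is_derive (0:R) 1 (fun h : R => f (x + h *: v)) d.
Proof.
have E : (fun h : R => h^-1 *: (f (x + (h *: 1 + 0) *: v) - f (x + 0 *: v))) =
  (fun h : R => h^-1 *: (f (h *: v + x) - f x)).
  apply/funext => h; rewrite scale0r !addr0; congr (_ *: (f _ - _)).
  by rewrite [h%:A]mulr1 addrC.
split => -[d1 d2]; first by split; rewrite /derivable /derive E.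
by move: d1 d2; rewrite /derivable /derive E => ? ?; split.
Qed.

Lemma is_derive_dirP f x v (d : R) : is_derive x v f d <->
  forall e : R, 0 < e ->
    \forall h \near (0 : R), `|f (x + h *: v) - f x - h * d| <= e * `|h|.
Proof.
rewrite is_derive_lineP is_derive1_epsP; split=> H e e0; have := H e e0;
  apply: filterS => h; by rewrite !subr0 scale0r addr0 mulrC.
Qed.

(** The increment is taken first along [w], then along the [i]-th axis. The second part is a partial
    derivative at an intermediate point by the mean value theorem, close to its value at [x] by
    continuity. *)
Lemma is_derive_add_dir f x w (c d : R) i : isC 1 f -> is_derive x w f d ->
  is_derive x (w + c *: ev i) f (d + c * partial i f x).
Proof.
move=> Cf /is_derive_dirP df; apply/is_derive_dirP => e e0.
have e20 : 0 < e / 2 by rewrite divr_gt0.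
have c0 : 0 < `|c| + 1 by rewrite ltr_wpDl.
have cp := isC_continuous (isC_partial i Cf).
have /cvgrPdist_le/(_ _ (divr_gt0 e20 c0)) := cp x.
move=> /nbhs_ballP[d1 /= d10 Hd1].
have k0 : 0 < `|w| + `|c| + 1 by rewrite ltr_wpDl// addr_ge0.
near=> h.
(* Small enough for the intermediate point [x + h *: w + s *: ev i], with [|s| <= |h * c|], to lie
   within [d1] of [x]. *)
have hd1 : `|h| < d1 / (`|w| + `|c| + 1).
  by near: h; apply: (@nbhs0_lt R R); rewrite divr_gt0.
have dfh : `|f (x + h *: w) - f x - h * d| <= e / 2 * `|h| by near: h; exact: df.
have [s sh] := partial_MVT i (x + h *: w) (h * c) Cf.
rewrite scalerDr scalerA addrA => fE.
have -> : f (x + h *: w + (h * c) *: ev i) - f x - h * (d + c * partial i f x) =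
  (f (x + h *: w + (h * c) *: ev i) - f (x + h *: w) - h * c * partial i f x)
  + (f (x + h *: w) - f x - h * d) by ring.
rewrite (le_trans (ler_normD _ _))// [in leRHS](splitr e) mulrDl lerD//.
rewrite fE -mulrBr normrM normrM -mulrA [leRHS]mulrC ler_wpM2l//.
have : `|partial i f x - partial i f (x + h *: w + s *: ev i)| <= e / 2 / (`|c| + 1).
  apply: Hd1; rewrite -ball_normE/= -addrA opprD addNKr normrN.
  rewrite (le_lt_trans (ler_normD _ _))// normrZ.
  rewrite (@le_lt_trans _ _ (`|h| * (`|w| + `|c| + 1)))// -?ltr_pdivlMr//.
  rewrite !mulrDr -addrA lerD2l (le_trans (normZ_delta _ _))//.
  by rewrite (le_trans sh)// normrM lerDl mulr1.
rewrite distrC => H; rewrite (le_trans (ler_wpM2l (normr_ge0 _) H))//.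
by rewrite mulrC -[leRHS](divfK (lt0r_neq0 c0)) ler_pM2l ?divr_gt0// lerDl.
Unshelve. all: by end_near. Qed.

(** [isC] speaks of partial derivatives only, whereas [radial] is a derivative in an oblique
    direction; the direction is built up one coordinate at a time. *)
Lemma directional_derivative f x v : isC 1 f ->
  is_derive x v f (\sum_(i < n) v ord0 i * partial i f x).
Proof.
move=> Cf.
rewrite [X in is_derive _ X](row_sum_delta v).
suff H (s : seq 'I_n) : is_derive x (\sum_(i <- s) v ord0 i *: ev i) f
    (\sum_(i <- s) v ord0 i * partial i f x) by exact: H.
elim: s => [|i s IH]; first by rewrite !big_nil; exact: is_derive0.
by rewrite !big_cons addrC [X in is_derive _ _ _ X]addrC; exact: is_derive_add_dir.
Qed.

End partials.

Arguments isC_continuous {R n k f} _ x.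

(** * Operations on C^k functions and symmetry of second derivatives *)

Section isC_closure.
Context {R : realType} {n : nat}.
Implicit Types (x y v : 'rV[R]_n) (f g : 'rV[R]_n -> R) (i j : 'I_n).
Local Notation ev i := (delta_mx ord0 i : 'rV[R]_n).

Lemma partialD i f g : isC 1 f -> isC 1 g ->
  partial i (fun x => f x + g x) = fun x => partial i f x + partial i g x.
Proof.
move=> Cf Cg; apply/funext => x.
by apply: deriveD; [exact: isC_derivable Cf|exact: isC_derivable Cg].
Qed.

Lemma partialM i f g : isC 1 f -> isC 1 g ->
  partial i (fun x => f x * g x) =
  fun x => f x * partial i g x + g x * partial i f x.
Proof.
move=> Cf Cg; apply/funext => x.
by apply: deriveM; [exact: isC_derivable Cf|exact: isC_derivable Cg].
Qed.

Lemma partial_cst i (c : R) : partial i (fun=> c) = fun=> 0.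
Proof. by apply/funext => x; exact: derive_cst. Qed.

Lemma isC_cst k (c : R) : isC k (fun _ : 'rV[R]_n => c).
Proof.
elim: k c => [|k IH] c; first by split => //; exact: cst_continuous.
split; first exact: cst_continuous.
move=> i; split; first by move=> x; exact: derivable_cst.
by rewrite partial_cst.
Qed.

Lemma isCD k f g : isC k f -> isC k g -> isC k (fun x => f x + g x).
Proof.
elim: k f g => [|k IH] f g Cf Cg.
  split => //; move=> x; exact: (continuousD (isC_continuous Cf x) (isC_continuous Cg x)).
split => [x|i].
  exact: (continuousD (isC_continuous Cf x) (isC_continuous Cg x)).
split=> [x|]; first by apply: derivableD; [exact: isC_derivable Cf|exact: isC_derivable Cg].
rewrite partialD; [|exact: isC_le Cf|exact: isC_le Cg].
by apply: IH; exact: isC_partial.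
Qed.

Lemma isCM k f g : isC k f -> isC k g -> isC k (fun x => f x * g x).
Proof.
elim: k f g => [|k IH] f g Cf Cg.
  split => //; move=> x; exact: (continuousM (isC_continuous Cf x) (isC_continuous Cg x)).
split => [x|i].
  exact: (continuousM (isC_continuous Cf x) (isC_continuous Cg x)).
split=> [x|]; first by apply: derivableM; [exact: isC_derivable Cf|exact: isC_derivable Cg].
rewrite partialM; [|exact: isC_le Cf|exact: isC_le Cg].
by apply: isCD; apply: IH; (exact: isC_partial || exact: isCS).
Qed.

Lemma isC_sum k (I : Type) (s : seq I) (F : I -> 'rV[R]_n -> R) :
  (forall l, isC k (F l)) -> isC k (fun x => \sum_(l <- s) F l x).
Proof.
move=> CF; elim: s => [|l s IH].
  by under eq_fun do rewrite big_nil; exact: isC_cst.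
by under eq_fun do rewrite big_cons; exact: isCD.
Qed.

Lemma partial_sum i (I : Type) (s : seq I) (F : I -> 'rV[R]_n -> R) :
  (forall l, isC 1 (F l)) ->
  partial i (fun x => \sum_(l <- s) F l x) =
  fun x => \sum_(l <- s) partial i (F l) x.
Proof.
move=> CF; elim: s => [|l s IH].
  under eq_fun do rewrite big_nil; rewrite partial_cst.
  by apply/funext => x; rewrite big_nil.
under eq_fun do rewrite big_cons; rewrite partialD//; last exact: isC_sum.
by apply/funext => x; rewrite big_cons IH.
Qed.

Lemma is_derive_coor (c : R) x i j :
  is_derive x (ev i) (fun y => y ord0 j - c) (i == j)%:R.
Proof.
apply/is_derive_dirP => e e0; apply/nbhs_ballP; exists 1 => [|h _]; first exact: ltr01.

rewrite !mxE eqxx/= eq_sym [X in `|X|](_ : _ = 0) ?normr0 ?mulr_ge0// ?(ltW e0)//.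
by ring.
Qed.

Lemma isC_coor k (c : R) j : isC k (fun x : 'rV[R]_n => x ord0 j - c).
Proof.
have cc : continuous (fun x : 'rV[R]_n => x ord0 j - c).
  by move=> x; apply: (continuousB (@coord_continuous R 1 n ord0 j x)); exact: cst_continuous.
case: k => [//|k]; split => // i; split => [x|].
  by have [] := is_derive_coor c x i j.
rewrite (_ : partial i _ = fun=> (i == j)%:R); first exact: isC_cst.
by apply/funext => x; have [_] := is_derive_coor c x i j.
Qed.

Lemma partial_coor (c : R) i j :
  partial i (fun x : 'rV[R]_n => x ord0 j - c) = fun=> (i == j)%:R.
Proof. by apply/funext => x; have [_] := is_derive_coor c x i j. Qed.

Lemma is_derive_expR_comp f x v (d : R) : is_derive x v f d ->
  is_derive x v (fun y => expR (f y)) (expR (f x) * d).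
Proof.
move=> /is_derive_lineP df; apply/is_derive_lineP.
have -> : f x = f (x + 0 *: v) by rewrite scale0r addr0.
exact: (@is_derive1_comp _ expR (fun h : R => f (x + h *: v))).
Qed.

Lemma partial_expR i f : isC 1 f ->
  partial i (fun x => expR (f x)) = fun x => expR (f x) * partial i f x.
Proof.
move=> Cf; apply/funext => x.
have [|_ h] := @is_derive_expR_comp f x (ev i) (partial i f x); last exact: h.
by apply: derivableP; exact: isC_derivable Cf.
Qed.

Lemma isC_expR k f : isC k f -> isC k (fun x => expR (f x)).
Proof.
elim: k f => [|k IH] f Cf.
  by split => // x; apply: continuous_comp; [exact: (isC_continuous Cf)|exact: continuous_expR].
split=> [x|i].
  by apply: continuous_comp; [exact: (isC_continuous Cf)|exact: continuous_expR].
split=> [x|].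
  have [|//] := @is_derive_expR_comp f x (ev i) (partial i f x).
  by apply: derivableP; exact: isC_derivable Cf.
rewrite partial_expR; last exact: isC_le Cf.
by apply: isCM; [exact/IH/isCS|exact: isC_partial].
Qed.

Lemma derive_shift_row f v a x :
  'D_v (fun y => f (y + a)) x = 'D_v f (x + a).
Proof. by rewrite /derive /=; under eq_fun do rewrite -addrA. Qed.

Lemma derivable_shift_row f v a x : derivable f (x + a) v ->
  derivable (fun y => f (y + a)) x v.
Proof. by rewrite /derivable /=; under [in X in _ -> X]eq_fun do rewrite -addrA. Qed.

(* The left-hand side is symmetric in [i] and [j], whence Schwarz's theorem. *)
Lemma second_difference i j f x (h : R) : isC 2 f ->
  exists s t : R, [/\ `|s| <= `|h|, `|t| <= `|h| &
    f (x + h *: ev i + h *: ev j) - f (x + h *: ev i)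
      - (f (x + h *: ev j) - f x) =
    h ^+ 2 * partial j (partial i f) (x + s *: ev i + t *: ev j)].
Proof.
move=> Cf; pose g y := f (y + h *: ev j) - f y.
have dg y : is_derive y (ev i) g (partial i f (y + h *: ev j) - partial i f y).
  split.
    apply: derivableB; last exact: isC_derivable Cf.
    by apply: derivable_shift_row; exact: isC_derivable Cf.
  rewrite deriveB; last exact: isC_derivable Cf.
    by rewrite derive_shift_row.
  by apply: derivable_shift_row; exact: isC_derivable Cf.
(* Two mean value theorems: for the difference [g] along the [i]-th axis, then for [partial i f]
   along the [j]-th. *)
have [s sh gE] := @line_MVT R n g (ev i) x h (fun y => let: DeriveDef d _ := dg y in d).
have [t th fE] := partial_MVT j (x + s *: ev i) h (isC_partial i Cf).
exists s, t; split => //.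
transitivity (g (x + h *: ev i) - g x); first by rewrite /g; ring.
rewrite gE; have [_ ->] := dg (x + s *: ev i).
by rewrite fE; ring.
Qed.

Lemma schwarz i j f : isC 2 f -> partial i (partial j f) = partial j (partial i f).
Proof.
move=> Cf; apply/funext => x.
set A := LHS; set B := RHS.
apply/eqP; rewrite -subr_eq0 -normr_le0; apply/ler_addgt0Pl => e e0; rewrite addr0.
have e2 : 0 < e / 2 by rewrite divr_gt0.
have cA := isC_continuous (isC_partial i (isC_partial j Cf)) x.
have cB := isC_continuous (isC_partial j (isC_partial i Cf)) x.
have /cvgrPdist_le/(_ _ e2)/nbhs_ballP[a /= a0 Ha] := cA.
have /cvgrPdist_le/(_ _ e2)/nbhs_ballP[b /= b0 Hb] := cB.
(* A third, so that two successive displacements of size at most [h] stay inside both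
   neighbourhoods. *)
pose h := Num.min a b / 3.
have m0 : 0 < Num.min a b by rewrite lt_min a0 b0.
have h0 : 0 < h by rewrite divr_gt0.
have hm : h + h < Num.min a b by rewrite /h; lra.
clearbody h.
have ballx c s t k l : Num.min a b <= c -> `|s| <= `|h| -> `|t| <= `|h| ->
    ball x c (x + s *: ev k + t *: ev l).
  move=> mc; rewrite (gtr0_norm h0) => sh th; rewrite -ball_normE/=.
  rewrite -addrA opprD addNKr normrN (lt_le_trans _ mc)// (le_lt_trans _ hm)//.
  rewrite (le_trans (ler_normD _ _))// lerD//.
    by rewrite (le_trans (normZ_delta _ _)).
  by rewrite (le_trans (normZ_delta _ _)).
have [s [t [sh th E1]]] := second_difference i j x h Cf.
have [s' [t' [sh' th' E2]]] := second_difference j i x h Cf.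
(* Both mixed derivatives, at their own intermediate points, equal the same second difference
   divided by [h ^+ 2]. *)
have E : partial j (partial i f) (x + s *: ev i + t *: ev j) =
         partial i (partial j f) (x + s' *: ev j + t' *: ev i).
  apply: (mulfI (_ : h ^+ 2 != 0)); first by rewrite expf_neq0// gt_eqF.
  have swap (a' b' c d : R) : a' - b' - (c - d) = a' - c - (b' - d) by ring.
  apply: (etrans (esym E1)); apply: etrans _ E2.
  by rewrite [x + h *: ev j + _]addrAC; exact: swap.
have ma : Num.min a b <= a by rewrite ge_min lexx.
have mb : Num.min a b <= b by rewrite ge_min lexx orbT.
have HA := Ha _ (ballx _ _ _ j i ma sh' th').
have HB := Hb _ (ballx _ _ _ i j mb sh th).
move: HA HB => /=; rewrite E -/A -/B.
move: (partial i (partial j f) (x + s' *: ev j + t' *: ev i)) => p.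
move: A B cA cB {Ha Hb E E1 E2} => A B _ _.
rewrite !ler_distl => /andP[A1 A2] /andP[B1 B2]; apply/andP; split; lra.
Qed.

End isC_closure.

(** * The Euler field and tangential operators *)

Section euler.
Context {R : realType} {n : nat}.
Implicit Types (x y v : 'rV[R]_n) (f g : 'rV[R]_n -> R) (i j : 'I_n).
Variable x0 : 'rV[R]_n.

Definition rcoor i x : R := x ord0 i - x0 ord0 i.

Definition rho2 x : R := \sum_(i < n) rcoor i x ^+ 2.

Definition euler f x : R := \sum_(i < n) rcoor i x * partial i f x.

Definition grad_dot f g x : R := \sum_(i < n) partial i f x * partial i g x.

Lemma rho2E x : rho2 x = enorm (x - x0) ^+ 2.
Proof. by rewrite sqr_enorm; apply: eq_bigr => i _; rewrite !mxE. Qed.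

Lemma isC_rcoor k i : isC k (rcoor i).
Proof. exact: isC_coor. Qed.

Lemma isC_rho2 k : isC k rho2.
Proof. by apply: isC_sum => i; apply: isCM; exact: isC_rcoor. Qed.

Lemma isC_euler k f : isC k.+1 f -> isC k (euler f).
Proof.
by move=> Cf; apply: isC_sum => i; apply: isCM; [exact: isC_rcoor|exact: isC_partial].
Qed.

Lemma isC_grad_dot k f g : isC k.+1 f -> isC k.+1 g -> isC k (grad_dot f g).
Proof. by move=> Cf Cg; apply: isC_sum => i; apply: isCM; exact: isC_partial. Qed.

Lemma isC_laplacian k f : isC k.+2 f -> isC k (laplacian f).
Proof. by move=> Cf; apply: isC_sum => i; do 2 apply: isC_partial. Qed.

Lemma eulerD f g x : isC 1 f -> isC 1 g ->
  euler (fun y => f y + g y) x = euler f x + euler g x.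
Proof.
move=> Cf Cg; rewrite /euler -big_split; apply: eq_bigr => i _.
by rewrite partialD// mulrDr.
Qed.

Lemma eulerM f g x : isC 1 f -> isC 1 g ->
  euler (fun y => f y * g y) x = f x * euler g x + g x * euler f x.
Proof.
move=> Cf Cg; rewrite /euler !mulr_sumr -big_split; apply: eq_bigr => i _.
by rewrite partialM//=; ring.
Qed.

Lemma euler_cst (c : R) x : euler (fun=> c) x = 0.
Proof. by rewrite /euler big1// => i _; rewrite partial_cst mulr0. Qed.

Lemma euler_scale c f x : isC 1 f -> euler (fun y => c * f y) x = c * euler f x.
Proof.
by move=> Cf; rewrite eulerM ?euler_cst ?mulr0 ?addr0//; exact: isC_cst.
Qed.

Lemma euler_sum (F : 'I_n -> 'rV[R]_n -> R) x : (forall l, isC 1 (F l)) ->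
  euler (fun y => \sum_(l < n) F l y) x = \sum_(l < n) euler (F l) x.
Proof.
move=> CF; rewrite /euler exchange_big; apply: eq_bigr => i _ /=.
by rewrite partial_sum// mulr_sumr.
Qed.

Lemma euler_expR f x : isC 1 f ->
  euler (fun y => expR (f y)) x = expR (f x) * euler f x.
Proof.
move=> Cf; rewrite /euler mulr_sumr; apply: eq_bigr => i _.
by rewrite partial_expR// mulrCA.
Qed.

Lemma partial_rcoor i j : partial i (rcoor j) = fun=> (i == j)%:R.
Proof. exact: partial_coor. Qed.

Lemma sum_delta (F : 'I_n -> R) j : \sum_(i < n) (i == j)%:R * F i = F j.
Proof.
by rewrite (bigD1 j)//= eqxx mul1r big1 ?addr0// => i /negbTE ->; rewrite mul0r.
Qed.

Lemma euler_rcoor j x : euler (rcoor j) x = rcoor j x.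
Proof.
rewrite -[RHS](sum_delta (fun i => rcoor i x)); apply: eq_bigr => i _.
by rewrite partial_rcoor mulrC.
Qed.

Lemma euler_rho2 x : euler rho2 x = 2 * rho2 x.
Proof.
rewrite /rho2 [LHS]euler_sum => [|i]; last by apply: isCM; exact: isC_rcoor.
rewrite mulr_sumr; apply: eq_bigr => i _.
by rewrite eulerM ?euler_rcoor; [ring|exact: isC_rcoor..].
Qed.

(** The commutator of [partial j] with the Euler field is [partial j]: differentiating the
    coefficient [rcoor j] gives the extra term, and Schwarz's theorem exchanges the rest. *)
Lemma partial_euler j f : isC 2 f ->
  partial j (euler f) = fun x => partial j f x + euler (partial j f) x.
Proof.
move=> Cf; rewrite /euler partial_sum => [|i]; last first.
  by apply: isCM; [exact: isC_rcoor|exact: isC_partial].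
apply/funext => x; rewrite -[X in X + _](sum_delta (fun i => partial i f x)).
rewrite -big_split; apply: eq_bigr => i _ /=.
rewrite partialM; [|exact: isC_rcoor|exact: isC_partial].
by rewrite partial_rcoor (schwarz j i Cf) eq_sym; ring.
Qed.

(** Each of the two gradients contributes one commutator from [partial_euler], whence the factor
    2. *)
Lemma euler_grad_dot f g x : isC 2 f -> isC 2 g ->
  euler (grad_dot f g) x =
  grad_dot (euler f) g x + grad_dot f (euler g) x - 2 * grad_dot f g x.
Proof.
move=> Cf Cg; rewrite /grad_dot [LHS]euler_sum => [|i]; last first.
  by apply: isCM; exact: isC_partial.
rewrite mulr_sumr -sumrN -!big_split; apply: eq_bigr => i _ /=.
rewrite eulerM; [|exact: isC_partial..].
rewrite (partial_euler i Cf) (partial_euler i Cg).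
move: (euler (partial i f) x) (euler (partial i g) x) => a b.
by move: (partial i f x) (partial i g x) => c d; ring.
Qed.

Lemma laplacian_euler f x : isC 3 f ->
  laplacian (euler f) x = euler (laplacian f) x + 2 * laplacian f x.
Proof.
move=> Cf; have C2f : isC 2 f by exact: isCS.
rewrite /laplacian euler_sum => [|i]; last by do 2 apply: isC_partial.
rewrite mulr_sumr -big_split; apply: eq_bigr => i _ /=.
rewrite (partial_euler i C2f) partialD; [|exact/isC_partial|]; last first.
  by apply: isC_euler; exact: isC_partial.
rewrite (partial_euler i (isC_partial i Cf)).
by move: (partial _ _ x) (euler _ x) => a b; ring.
Qed.

(* [|x - x0|^2] times the product of the tangential gradients. *)
Definition tan_dot f g x : R := rho2 x * grad_dot f g x - euler f x * euler g x.

(* [|x - x0|^2] times the Laplacian along the sphere through [x]. *)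
Definition tan_laplacian f x : R :=
  rho2 x * laplacian f x - (n%:R - 2) * euler f x - euler (euler f) x.

Lemma isCN k f : isC k f -> isC k (fun x => - f x).
Proof.
move=> Cf; have -> : (fun x => - f x) = (fun x => -1 * f x).
  by apply/funext => x; rewrite mulN1r.
by apply: isCM => //; exact: isC_cst.
Qed.

Lemma isCB k f g : isC k f -> isC k g -> isC k (fun x => f x - g x).
Proof. by move=> Cf Cg; apply: isCD => //; exact: isCN. Qed.

Lemma isC_tan_dot k f g : isC k.+1 f -> isC k.+1 g -> isC k (tan_dot f g).
Proof.
move=> Cf Cg; apply: isCB; apply: isCM.
- exact: isC_rho2.
- exact: isC_grad_dot.
- exact: isC_euler.
- exact: isC_euler.
Qed.

Lemma isC_tan_laplacian k f : isC k.+2 f -> isC k (tan_laplacian f).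
Proof.
move=> Cf; apply: isCB; last by do 2 apply: isC_euler.
apply: isCB; apply: isCM.
- exact: isC_rho2.
- exact: isC_laplacian.
- exact: isC_cst.
- exact/isCS/isC_euler.
Qed.

Lemma eulerB f g x : isC 1 f -> isC 1 g ->
  euler (fun y => f y - g y) x = euler f x - euler g x.
Proof.
move=> Cf Cg; rewrite eulerD//; last exact: isCN.
have -> : (fun y => - g y) = (fun y => -1 * g y).
  by apply/funext => y; rewrite mulN1r.
by rewrite euler_scale// mulN1r.
Qed.

(** The product rule holds without a correction term because [euler_rho2] contributes a factor 2
    that cancels the one of [euler_grad_dot]: the form has degree 0 under dilations. *)
Lemma euler_tan_dot f g x : isC 2 f -> isC 2 g ->
  euler (tan_dot f g) x = tan_dot (euler f) g x + tan_dot f (euler g) x.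
Proof.
move=> Cf Cg; have Cef := isC_euler Cf; have Ceg := isC_euler Cg.
have C1f : isC 1 (euler f) by []; have C1g : isC 1 (euler g) by [].
have Cd : isC 1 (grad_dot f g) by exact: isC_grad_dot.
rewrite (@eulerB (fun y => rho2 y * grad_dot f g y)); last first.
- exact: isCM.
- by apply: isCM => //; exact: isC_rho2.
rewrite (eulerM x (isC_rho2 1) Cd) (eulerM x C1f C1g) euler_rho2 euler_grad_dot//.
rewrite /tan_dot; move: (grad_dot f g x) (grad_dot _ g x) (grad_dot f _ x) => a b c.
move: (euler f x) (euler g x) (euler (euler f) x) (euler (euler g) x) (rho2 x).
by move=> d e k l m; ring.
Qed.

Lemma cauchy_schwarz (a b : 'I_n -> R) :
  (\sum_(i < n) a i * b i) ^+ 2 <= (\sum_(i < n) a i ^+ 2) * \sum_(i < n) b i ^+ 2.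
Proof.
rewrite -subr_ge0.
set A := \sum_(i < n) a i ^+ 2; set B := \sum_(i < n) b i ^+ 2.
set C := \sum_(i < n) a i * b i.
have A0 : 0 <= A by apply: sumr_ge0 => i _; exact: sqr_ge0.
have [A00|An0] := eqVneq A 0.
  have a0 i : a i = 0.
    apply/eqP; rewrite -sqrf_eq0; move/eqP: A00.
    by rewrite psumr_eq0 => [/allP/(_ i (mem_index_enum i))//|j _]; exact: sqr_ge0.
  by rewrite A00 mul0r /C big1 ?expr0n ?subr0// => i _; rewrite a0 mul0r.
(* This sum of squares equals [A * (A * B - C ^+ 2)], and [A] is now positive. *)
have : 0 <= \sum_(i < n) (A * b i - C * a i) ^+ 2.
  by apply: sumr_ge0 => i _; exact: sqr_ge0.
have -> : \sum_(i < n) (A * b i - C * a i) ^+ 2 = A * (A * B - C ^+ 2).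
  transitivity (\sum_(i < n) (A ^+ 2 * b i ^+ 2 + - (2 * A * C) * (a i * b i)
      + C ^+ 2 * a i ^+ 2)); first by apply: eq_bigr => i _; ring.
  by rewrite !big_split /= -!mulr_sumr -/A -/B -/C; ring.
by rewrite pmulr_rge0// lt_neqAle eq_sym An0.
Qed.

Lemma tan_dot_ge0 f x : 0 <= tan_dot f f x.
Proof.
by rewrite subr_ge0 -expr2 (le_trans (cauchy_schwarz _ _)).
Qed.

End euler.

(** * Divergence theorem on balls *)

Section linearity.
Context {R : realType} {n : nat}.
Implicit Types (x y v : 'rV[R]_n) (f g : 'rV[R]_n -> R) (i j : 'I_n) (r c : R).
Variable x0 : 'rV[R]_n.
Local Notation ball_int := (ball_int x0).
Local Notation sphere_int := (sphere_int x0).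

Lemma ball_intD f g r : continuous f -> continuous g ->
  ball_int (fun x => f x + g x) r = ball_int f r + ball_int g r.
Proof.
move=> cf cg; apply: RintegralD; [exact: measurable_eball|
  exact: continuous_integrable_eball..].
Qed.

Lemma ball_intZ c f r : continuous f ->
  ball_int (fun x => c * f x) r = c * ball_int f r.
Proof.
by move=> cf; apply: RintegralZl; [exact: measurable_eball|
  exact: continuous_integrable_eball].
Qed.

Lemma sphere_measure_fin r : (sphere_measure x0 r (esphere x0 r) < +oo)%E.
Proof.
rewrite /sphere_measure lte_mul_pinfty//.
apply: le_lt_trans (lebesgue_row_eball_fin x0 r).
have mB := measurable_eball x0 r.
have mP : measurable (sphere_proj x0 r @^-1` esphere x0 r).
  rewrite -[X in measurable X]setTI.
  by apply: measurable_sphere_proj => //; exact: measurable_esphere.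
apply: le_measure; [rewrite inE; exact: measurableI|by rewrite inE|].
exact: subIsetr.
Qed.

Lemma continuous_integrable_esphere f r : continuous f ->
  (sphere_measure x0 r).-integrable (esphere x0 r) (EFin \o f).
Proof.
move=> cf; apply: measurable_bounded_integrable.
- exact: measurable_esphere.
- exact: sphere_measure_fin.
- by apply: measurable_funTS; exact: measurable_continuous_row.
- have [M M0 HM] := bounded_on_cube x0 r cf.
  exists M; split; first by rewrite num_real.
  by move=> N MN x /= /esphere_cube/HM => H; rewrite (le_trans H)// ltW.
Qed.

Lemma sphere_intD f g r : continuous f -> continuous g ->
  sphere_int (fun x => f x + g x) r = sphere_int f r + sphere_int g r.
Proof.
move=> cf cg; apply: RintegralD; [exact: measurable_esphere|
  exact: continuous_integrable_esphere..].
Qed.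

Lemma sphere_intZ c f r : continuous f ->
  sphere_int (fun x => c * f x) r = c * sphere_int f r.
Proof.
by move=> cf; apply: RintegralZl; [exact: measurable_esphere|
  exact: continuous_integrable_esphere].
Qed.

Lemma eq_sphere_int f g r : (forall x, esphere x0 r x -> f x = g x) ->
  sphere_int f r = sphere_int g r.
Proof. by move=> fg; apply: eq_Rintegral => x; rewrite inE; exact: fg. Qed.

Lemma eq_ball_int f g r : f =1 g -> ball_int f r = ball_int g r.
Proof. by move=> fg; apply: eq_Rintegral => x _; exact: fg. Qed.

(** Constancy of [rho2] on the sphere is what cancels boundary terms when weighted ball identities
    are differentiated in the radius. *)
Lemma sphere_int_rho2 f r : continuous f ->
  sphere_int (fun x => rho2 x0 x * f x) r = r ^+ 2 * sphere_int f r.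
Proof.
move=> cf; rewrite -sphere_intZ//; apply: eq_sphere_int => x /= xr.
by rewrite rho2E xr.
Qed.

Lemma ball_int_sum (F : 'I_n -> 'rV[R]_n -> R) r : (forall i, continuous (F i)) ->
  ball_int (fun x => \sum_(i < n) F i x) r = \sum_(i < n) ball_int (F i) r.
Proof.
move=> cF; suff H (s : seq 'I_n) : continuous (fun x => \sum_(i <- s) F i x) /\
  ball_int (fun x => \sum_(i <- s) F i x) r = \sum_(i <- s) ball_int (F i) r.
  by have [] := H (index_enum _).
elim: s => [|i s [IH1 IH2]].
  under eq_fun do rewrite big_nil; split; first exact: cst_continuous.
  by rewrite big_nil /ball_int /Rintegral integral0.
have E : (fun x => \sum_(j <- i :: s) F j x) =
    (fun x => F i x + \sum_(j <- s) F j x) by apply/funext => x; rewrite big_cons.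
rewrite E; split; first by move=> x; exact: (continuousD (cF i x) (IH1 x)).
by rewrite ball_intD// big_cons IH2.
Qed.

Lemma sphere_int_sum (F : 'I_n -> 'rV[R]_n -> R) r : (forall i, continuous (F i)) ->
  sphere_int (fun x => \sum_(i < n) F i x) r = \sum_(i < n) sphere_int (F i) r.
Proof.
move=> cF; suff H (s : seq 'I_n) : continuous (fun x => \sum_(i <- s) F i x) /\
  sphere_int (fun x => \sum_(i <- s) F i x) r = \sum_(i <- s) sphere_int (F i) r.
  by have [] := H (index_enum _).
elim: s => [|i s [IH1 IH2]].
  under eq_fun do rewrite big_nil; split; first exact: cst_continuous.
  by rewrite big_nil /sphere_int /Rintegral integral0.
have E : (fun x => \sum_(j <- i :: s) F j x) =
    (fun x => F i x + \sum_(j <- s) F j x) by apply/funext => x; rewrite big_cons.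
rewrite E; split; first by move=> x; exact: (continuousD (cF i x) (IH1 x)).
by rewrite sphere_intD// big_cons IH2.
Qed.

End linearity.

(** * Integrals of compactly supported functions *)

Section compact_support.
Context {R : realType} {n : nat}.
Implicit Types (x y v : 'rV[R]_n) (f g : 'rV[R]_n -> R) (i j : 'I_n) (r c : R).
Local Notation mu := (@lebesgue_row R n).
Local Notation ev i := (delta_mx ord0 i : 'rV[R]_n).
Variable x0 : 'rV[R]_n.

Lemma integrable_cube_supp f r : continuous f ->
  (forall x, ~ cube x0 r x -> f x = 0) -> mu.-integrable setT (EFin \o f).
Proof.
move=> cf f0; have [M M0 HM] := bounded_on_cube x0 r cf.
have -> : EFin \o f = (EFin \o f) \_ (cube x0 r).
  apply/funext => x; rewrite /patch; case: ifPn => //.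
  by rewrite notin_setE /= => /f0 ->.
apply/(integrable_mkcond _ (measurable_cube x0 r)).1.
apply: measurable_bounded_integrable.
- exact: measurable_cube.
- exact: lebesgue_row_cube_fin.
- by apply: measurable_funTS; exact: measurable_continuous_row.
- exists M; split; first by rewrite num_real.
  by move=> N MN x /= /HM => H; rewrite (le_trans H)// ltW.
Qed.

Lemma Rintegral_translate f r (a : 'rV[R]_n) : continuous f ->
  (forall x, ~ cube x0 r x -> f x = 0) ->
  \int[mu]_x f (x + a) = \int[mu]_x f x /\
  mu.-integrable setT (fun x => (f (x + a))%:E).
Proof.
move=> cf f0.
have ia : mu.-integrable setT (fun x => (f (x + a))%:E).
  pose g x := f (x + a).
  have cg : continuous g.
    move=> x; apply: continuous_comp; last exact: cf.
    by apply: continuousD => //; exact: cst_continuous.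
  apply: (@integrable_cube_supp g (r + enorm a) cg) => x xr; apply: f0 => H.
  apply: xr => i; have := H i; rewrite !in_itv/= !mxE => /andP[h1 h2].
  have := coor_le_enorm a i; rewrite ler_norml => /andP[h3 h4].
  apply/andP; split; lra.
split => //.
rewrite [RHS](@Rintegral_affine_row _ _ a 1)//.
- by rewrite expr1n mul1r preimage_setT; apply: eq_Rintegral => x _; rewrite scale1r addrC.
- exact: measurable_continuous_row.
- rewrite preimage_setT; under eq_fun do rewrite scale1r addrC; exact: ia.
Qed.

Lemma cube_shift x r (s c : R) i : cube x0 r (x + s *: ev i) -> `|s| <= c ->
  cube x0 (r + c) x.
Proof.
move=> H sc j; have := H j; rewrite !mxE eqxx/= !in_itv/= => /andP[h1 h2].
have : `|s * (j == i)%:R| <= c.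
  by rewrite normrM; case: eqP; rewrite ?normr1 ?normr0 ?mulr1 ?mulr0// (le_trans _ sc).
rewrite ler_norml => /andP[h3 h4]; apply/andP; split; lra.
Qed.

(** Difference quotients have integral 0 by translation invariance and converge pointwise to the
    partial derivative; dominated convergence passes to the limit. *)
Lemma Rintegral_partial_supp f r i : isC 1 f ->
  (forall x, ~ cube x0 r x -> f x = 0) -> \int[mu]_x partial i f x = 0.
Proof.
move=> Cf f0; have cf := isC_continuous Cf.
have cp := isC_continuous (isC_partial i Cf).
(* Steps have size at most 1, so the quotients vanish off the cube of half-side [r + 1]; the mean
   value point may be 1 further away. *)
have [M M0 HM] := bounded_on_cube x0 (r + 2) cp.
pose t (k : nat) : R := k.+1%:R^-1.
have t0 k : t k != 0 by rewrite invr_eq0.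
have t1 k : `|t k| <= 1.
  by rewrite ger0_norm ?invr_ge0// invf_le1 ?ltr0n// ler1n.
pose q k x := (t k)^-1 * (f (x + t k *: ev i) - f x).
have iq k : mu.-integrable setT (EFin \o q k).
  have [_ i1] := Rintegral_translate (t k *: ev i) cf f0.
  have i2 := integrableB measurableT i1 (integrable_cube_supp cf f0).
  exact: (integrableZl measurableT (t k)^-1 i2).
have q0 k : (\int[mu]_x (q k x)%:E = 0)%E.
  rewrite -[LHS]fineK; last exact: (integrable_fin_num measurableT (iq k)).
  congr EFin; rewrite -/(Rintegral _ _ _) /q.
  have [E i1] := Rintegral_translate (t k *: ev i) cf f0.
  have i2 := integrable_cube_supp cf f0.
  rewrite RintegralZl//; last exact: (integrableB measurableT i1 i2).
  by rewrite RintegralB// E subrr mulr0.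
have qcvg x : q ^~ x @ \oo --> partial i f x.
  have /is_derive_dirP df : is_derive x (ev i) f (partial i f x).
    by apply: derivableP; exact: isC_derivable Cf.
  apply/cvgrPdist_le => e e0; have [d /= d0 Hd] := (df e e0).
  near=> k; have td : `|t k| < d.
    rewrite ger0_norm ?invr_ge0//; near: k; exact: near_infty_natSinv_lt (PosNum d0).
  have := Hd (t k); rewrite /= sub0r normrN => /(_ td).
  have -> : f (x + t k *: ev i) - f x - t k * partial i f x =
      (q k x - partial i f x) * t k.
    by rewrite /q mulrBl mulrAC mulVf// mul1r [t k * _]mulrC.
  by rewrite normrM ler_pM2r ?normr_gt0// distrC.
pose G : 'rV[R]_n -> \bar R := (EFin \o cst M) \_ (cube x0 (r + 1)).
have qM k x : (`|(q k x)%:E| <= G x)%E.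
  rewrite /G /patch; case: ifPn; rewrite ?inE ?notin_setE => xr /=; rewrite lee_fin.
    have [s st E] := partial_MVT i x (t k) Cf.
    rewrite /q E mulKf//; apply: HM.
    have xE : x + s *: ev i + - s *: ev i = x.
      by rewrite -addrA -scalerDl subrr scale0r addr0.
    have -> : r + 2 = r + 1 + 1 by ring.
    apply: (@cube_shift _ _ (- s) 1 i); first by rewrite xE.
    by rewrite normrN (le_trans st).
  rewrite /q !f0 ?subr0 ?mulr0 ?normr0//.
    by move=> h; apply: xr => j; have := h j; rewrite !in_itv/= => /andP[? ?]; apply/andP; split; lra.
  by move=> /cube_shift/(_ (t1 k)).
have := @dominated_convergence _ _ R mu setT measurableT (fun k => EFin \o q k)
  (EFin \o partial i f) G.
case.
- by move=> k; exact: (measurable_int mu (iq k)).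
- by apply/measurable_EFinP; exact: measurable_continuous_row.
- by apply: aeW => x _; apply: cvg_EFin; [exact: nearW|exact: qcvg].
- apply/(integrable_mkcond _ (measurable_cube x0 (r + 1))).1.
  apply: measurable_bounded_integrable.
  + exact: measurable_cube.
  + exact: lebesgue_row_cube_fin.
  + exact: measurable_cst.
  + by exists M; split; [rewrite num_real|move=> N MN x _ /=; rewrite ger0_norm// ltW].
- by apply: aeW => x k _; exact: qM.
move=> _ _; rewrite (_ : (fun k => _) = cst 0%E); last first.
  by apply/funext => k; exact: q0.
move=> /(cvg_unique _ (cvg_cst _)) => E.
by rewrite /Rintegral -E.
Unshelve. all: by end_near. Qed.

End compact_support.

Section divergence.
Context {R : realType} {n : nat}.
Implicit Types (x y v : 'rV[R]_n) (f g : 'rV[R]_n -> R) (i j : 'I_n) (r c : R).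
Local Notation ev i := (delta_mx ord0 i : 'rV[R]_n).
Variable x0 : 'rV[R]_n.
Local Notation ball_int := (ball_int x0).
Local Notation sphere_int := (sphere_int x0).
Local Notation rho2 := (rho2 x0).
Local Notation rcoor := (rcoor x0).

Lemma continuous_add f g : continuous f -> continuous g ->
  continuous (fun x => f x + g x).
Proof. by move=> cf cg x; exact: (continuousD (cf x) (cg x)). Qed.

Lemma continuous_scale c f : continuous f -> continuous (fun x => c * f x).
Proof.
move=> cf; have Cf : isC 0 f by [].
exact: (isC_continuous (isCM (isC_cst 0 c) Cf)).
Qed.

(** Identities in the radius hold for positive radii only, which suffices since derivatives are
    local. *)
Lemma is_derive_unique_pos (F G : R -> R) (r a b : R) : 0 < r ->
  (forall s, 0 < s -> F s = G s) ->
  is_derive r 1 F a -> is_derive r 1 G b -> a = b.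
Proof.
move=> r0 FG [_ <-] [_ <-]; apply: near_eq_derive.
near=> s; apply: FG; near: s; exact: lt_nbhsr.
Unshelve. all: by end_near. Qed.

Lemma is_derive_sqr_pos (t : R) :
  is_derive t 1 (fun s : R => Num.max s 0 ^+ 2) (2 * Num.max t 0).
Proof.
apply/is_derive1_epsP => e e0; near=> s.
have st : `|s - t| <= e.
  by near: s; apply/nbhs_ballP; exists e => //= s; rewrite /ball/= distrC => /ltW.
(* For every combination of signs the remainder is at most [(s - t) ^+ 2]. *)
rewrite (@le_trans _ _ (`|s - t| ^+ 2))//; last by rewrite expr2 ler_wpM2r.
rewrite real_normK ?num_real// ler_norml.
have sq0 := sqr_ge0 (s - t); have s2 := sqr_ge0 s; have t2 := sqr_ge0 t.
have [s0|s0] := leP s 0; have [t0|t0] := leP t 0.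
- by rewrite ?(max_r s0) ?(max_r t0); apply/andP; split; nra.
- have st0 : s * t <= 0 by rewrite mulr_le0_ge0// ltW.
  by apply/andP; split; nra.
- have st0 : s * t <= 0 by rewrite mulr_ge0_le0// ltW.
  by apply/andP; split; nra.
- by apply/andP; split; nra.
Unshelve. all: by end_near. Qed.

Lemma partial_rho2 i : partial i rho2 = fun x => 2 * rcoor i x.
Proof.
rewrite /rho2 partial_sum => [|j]; last by apply: isCM; exact: isC_rcoor.
apply/funext => x; rewrite -(sum_delta (fun j => 2 * rcoor j x)).
apply: eq_bigr => j _; rewrite partialM ?partial_rcoor; [|exact: isC_rcoor..].
by rewrite eq_sym; ring.
Qed.

(** The positive part is squared because the first power would only be Lipschitz across the sphere,
    whereas the square is C^1. *)
Definition bump r x : R := Num.max (r ^+ 2 - rho2 x) 0 ^+ 2.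

Lemma is_derive_bump r i x :
  is_derive x (ev i) (bump r) (2 * Num.max (r ^+ 2 - rho2 x) 0 * (- (2 * rcoor i x))).
Proof.
have dq : is_derive x (ev i) (fun y => r ^+ 2 - rho2 y) (- (2 * rcoor i x)).
  have -> : - (2 * rcoor i x) = 0 - partial i rho2 x by rewrite partial_rho2 sub0r.
  have d1 := derivableP (@isC_derivable R n 0 rho2 i x (isC_rho2 x0 1)).
  exact: (@is_deriveB _ _ _ (cst (r ^+ 2)) rho2 _ _ _ _ (is_derive_cst _ _ _) d1).
move/is_derive_lineP: dq => dq; apply/is_derive_lineP.
have E : x = x + 0 *: ev i by rewrite scale0r addr0.
rewrite [X in Num.max (_ - rho2 X)]E.
exact: (@is_derive1_comp _ (fun s => Num.max s 0 ^+ 2)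
  (fun h : R => r ^+ 2 - rho2 (x + h *: ev i)) _ _ _ (is_derive_sqr_pos _) dq).
Qed.

Lemma isC_bump r : isC 1 (bump r).
Proof.
have cq : continuous (fun x => Num.max (r ^+ 2 - rho2 x) 0).
  have Cq : isC 0 (fun x => r ^+ 2 - rho2 x).
    by apply: isCB; [exact: isC_cst|exact: isC_rho2].
  have cm : continuous (fun s : R => Num.max s 0).
    rewrite (_ : (fun s : R => _) = (fun s => (s + `|s|) * 2^-1)); last first.
      by apply/funext => s; rewrite maxr_absE addr0 subr0.
    move=> s; apply: cvgM; last exact: cvg_cst.
    by apply: cvgD; [exact: cvg_id|exact: norm_continuous].
  by move=> x; exact: (continuous_comp (isC_continuous Cq x) (cm _)).
split; first by move=> x; exact: (continuousM (cq x) (cq x)).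
move=> i; split; first by move=> x; have [] := is_derive_bump r i x.
rewrite (_ : partial i _ = fun x =>
    2 * Num.max (r ^+ 2 - rho2 x) 0 * (- (2 * rcoor i x))); last first.
  by apply/funext => x; have [_] := is_derive_bump r i x.
have c1 : isC 0 (fun x => Num.max (r ^+ 2 - rho2 x) 0) by [].
apply: isCM; first by apply: isCM => //; exact: isC_cst.
by apply: isCN; apply: isCM; [exact: isC_cst|exact: isC_rcoor].
Qed.

Lemma rho2_eball r x : 0 < r -> (rho2 x < r ^+ 2) = (enorm (x - x0) < r).
Proof. by move=> r0; rewrite rho2E ltr_pXn2r// nnegrE ?enorm_ge0// ltW. Qed.

(* The weight [(r ^+ 2 - rho2) ^+ 2], truncated outside the ball, is C^1 with
   compact support, and the integral of a partial derivative vanishes by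
   translation invariance. *)
Lemma weighted_divergence i f r : isC 1 f -> 0 < r ->
  ball_int (fun x => (r ^+ 2 - rho2 x) ^+ 2 * partial i f x) r =
  4 * ball_int (fun x => (r ^+ 2 - rho2 x) * (rcoor i x * f x)) r.
Proof.
move=> Cf r0; have Cb := isC_bump r.
have cp : isC 0 (partial i f) by exact: isC_partial.
have Cq : isC 0 (fun x => r ^+ 2 - rho2 x).
  by apply: isCB; [exact: isC_cst|exact: isC_rho2].
have Cy : isC 0 (fun x => rcoor i x * f x).
  by apply: isCM; [exact: isC_rcoor|exact: isCS].
have C1 : isC 0 (fun x => (r ^+ 2 - rho2 x) ^+ 2 * partial i f x).
  by apply: isCM => //; exact: (isCM Cq Cq).
have C2 : isC 0 (fun x => (r ^+ 2 - rho2 x) * (rcoor i x * f x)) by exact: isCM.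
have := @Rintegral_partial_supp R n x0 (fun x => bump r x * f x) r i (isCM Cb Cf).
(* Inside the ball this is the product rule, with -4 = 2 * (-2) from the square and from
   [partial_rho2]; outside, both [bump] and its gradient vanish. *)
rewrite (_ : partial i _ = (fun x => (r ^+ 2 - rho2 x) ^+ 2 * partial i f x +
    -4 * ((r ^+ 2 - rho2 x) * (rcoor i x * f x))) \_ (eball x0 r)); last first.
  rewrite partialM//; apply/funext => x.
  have [_] := is_derive_bump r i x; rewrite -/(partial i (bump r) x) => ->.
  rewrite /bump /patch; case: ifPn; rewrite ?inE ?notin_setE /eball/= => xr.
    rewrite -rho2_eball// in xr.
    rewrite max_l; last by rewrite subr_ge0 ltW.
    by move: (partial i f x) => a; ring.
  rewrite max_r ?mulr0 ?mul0r ?expr0n ?mulr0 ?mul0r ?addr0//.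
  by rewrite subr_le0 leNgt rho2_eball//; exact/negP.
move=> H; have H0 : forall x, ~ cube x0 r x -> bump r x * f x = 0.
  move=> x xr; rewrite /bump max_r ?expr0n ?mul0r//.
  rewrite subr_le0 leNgt rho2_eball//; apply/negP => h.
  by apply: xr; exact: eball_cube.
move: (H H0); rewrite -Rintegral_mkcond -/(ball_int _ r).
rewrite ball_intD; [|exact: isC_continuous C1|]; last first.
  by apply: (@isC_continuous _ _ 0); apply: isCM => //; exact: isC_cst.
rewrite ball_intZ; last exact: isC_continuous C2.
by move/eqP; rewrite mulNr subr_eq0 => /eqP.
Qed.

(* Differentiating [weighted_divergence] twice in [r] removes the weight. *)
Theorem divergence_ball i f r : isC 1 f -> 0 < r ->
  ball_int (partial i f) r = sphere_int (fun x => rcoor i x * f x) r / r.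
Proof.
move=> Cf.
have C0 : isC 0 (partial i f) by exact: isC_partial.
have C1 : isC 0 (fun x => rho2 x * partial i f x).
  by apply: isCM => //; exact: isC_rho2.
have C2 : isC 0 (fun x => rho2 x * (rho2 x * partial i f x)).
  by apply: isCM => //; exact: isC_rho2.
have D0 : isC 0 (fun x => rcoor i x * f x).
  by apply: isCM; [exact: isC_rcoor|exact: isCS].
have D1 : isC 0 (fun x => rho2 x * (rcoor i x * f x)).
  by apply: isCM => //; exact: isC_rho2.
have c0 := isC_continuous C0; have c1 := isC_continuous C1.
have c2 := isC_continuous C2; have d0 := isC_continuous D0.
have d1 := isC_continuous D1.
pose a0 := ball_int (partial i f).
pose a1 := ball_int (fun x => rho2 x * partial i f x).
pose a2 := ball_int (fun x => rho2 x * (rho2 x * partial i f x)).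
pose b0 := ball_int (fun x => rcoor i x * f x).
pose b1 := ball_int (fun x => rho2 x * (rcoor i x * f x)).
(* Expanding the weight takes the radius out of the integrands, so that the product rule and
   [is_derive_ball_int] apply. *)
have E1 s : 0 < s -> s ^+ 4 * a0 s + (-2) * (s ^+ 2 * a1 s) + a2 s =
    4 * (s ^+ 2 * b0 s) + (-4) * b1 s.
  move=> s0; have := weighted_divergence i Cf s0.
  have -> : ball_int (fun x => (s ^+ 2 - rho2 x) ^+ 2 * partial i f x) s =
      s ^+ 4 * a0 s + (-2 * s ^+ 2) * a1 s + a2 s.
    rewrite -!ball_intZ// -!ball_intD//.
    - apply: eq_ball_int => x; move: (partial i f x) => a; ring.
    - by apply: continuous_add; exact: continuous_scale.
    - exact: continuous_scale.
    - exact: continuous_scale.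
  have -> : ball_int (fun x => (s ^+ 2 - rho2 x) * (rcoor i x * f x)) s =
      s ^+ 2 * b0 s + (-1) * b1 s.
    rewrite -!ball_intZ// -!ball_intD//.
    - apply: eq_ball_int => x; ring.
    - exact: continuous_scale.
    - exact: continuous_scale.
  move=> E; rewrite [_ * (_ * a1 s)]mulrA E; ring.
(* The derivative of [E1] divided by [4 * s]: as [rho2 = s ^+ 2] on the sphere, the sphere integrals
   have total coefficients [1 - 2 + 1] on the left and [4 - 4] on the right. *)
have E2 s : 0 < s -> s ^+ 2 * a0 s + (-1) * a1 s = 2 * b0 s.
  move=> s0.
  have da0 := is_derive_ball_int x0 c0 s0.
  have da1 := is_derive_ball_int x0 c1 s0.
  have da2 := is_derive_ball_int x0 c2 s0.
  have db0 := is_derive_ball_int x0 d0 s0.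
  have db1 := is_derive_ball_int x0 d1 s0.
  have dl := is_derive_addf (is_derive_addf (is_derive_mulf (is_derive_expn 4 s) da0)
    (is_derive_scalef (-2) (is_derive_mulf (is_derive_expn 2 s) da1))) da2.
  have dr := is_derive_addf (is_derive_scalef 4 (is_derive_mulf (is_derive_expn 2 s) db0))
    (is_derive_scalef (-4) db1).
  have := is_derive_unique_pos s0 E1 dl dr.
  rewrite !sphere_int_rho2//= expr1 -/(a0 s) -/(a1 s) -/(b0 s).
  move: (sphere_int _ s) (sphere_int _ s) (a0 s) (a1 s) (b0 s) => p q a b c E.
  apply: (mulfI (_ : 4 * s != 0)); first by rewrite mulf_neq0// gt_eqF.
  by apply/eqP; rewrite -subr_eq0; move/eqP: E; rewrite -subr_eq0 => /eqP E;
    apply/eqP; rewrite -E; ring.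
move=> r0.
(* Differentiating [E2]: the sphere integrals on the left cancel again, and the right-hand side
   leaves twice the flux. *)
have da0 := is_derive_ball_int x0 c0 r0.
have da1 := is_derive_ball_int x0 c1 r0.
have db0 := is_derive_ball_int x0 d0 r0.
have dl := is_derive_addf (is_derive_mulf (is_derive_expn 2 r) da0)
  (is_derive_scalef (-1) da1).
have := is_derive_unique_pos r0 E2 dl (is_derive_scalef 2 db0).
rewrite sphere_int_rho2//= expr1.
move: (sphere_int _ r) (sphere_int _ r) (ball_int _ r) => p q a E.
apply: (mulIf (_ : 2 * r != 0)); first by rewrite mulf_neq0// gt_eqF.
rewrite [RHS]mulrCA divfK ?gt_eqF//.
by apply/eqP; rewrite -subr_eq0; move/eqP: E; rewrite -subr_eq0 => /eqP E;
  apply/eqP; rewrite -E; ring.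
Qed.

End divergence.

Arguments continuous_add {R n f g} _ _ x.
Arguments continuous_scale {R n} c {f} _ x.

(** * Spherical means *)

Section spherical_means.
Context {R : realType} {n : nat}.
Implicit Types (x y v : 'rV[R]_n) (f g : 'rV[R]_n -> R) (i j : 'I_n) (r c : R).
Variable x0 : 'rV[R]_n.
Local Notation ball_int := (ball_int x0).
Local Notation sphere_int := (sphere_int x0).
Local Notation rho2 := (rho2 x0).
Local Notation rcoor := (rcoor x0).
Local Notation euler := (euler x0).

Lemma continuous_mul f g : continuous f -> continuous g ->
  continuous (fun x => f x * g x).
Proof. by move=> cf cg x; exact: (continuousM (cf x) (cg x)). Qed.

(** Divergence theorem for the field [f(x) (x - x0)]: its divergence is [n f + L f], and its flux
    density on the sphere is [r f]. *)
Lemma sphere_int_euler f r : isC 1 f -> 0 < r ->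
  r * sphere_int f r = ball_int (fun x => n%:R * f x + euler f x) r.
Proof.
move=> Cf r0; have cf := isC_continuous Cf.
have Cy i : isC 1 (fun x => rcoor i x * f x) by apply: isCM => //; exact: isC_rcoor.
have cyy i : continuous (fun x => rcoor i x * (rcoor i x * f x)).
  by apply: continuous_mul; exact: (isC_continuous (isC_rcoor x0 0 i)) ||
     exact: (isC_continuous (Cy i)).
transitivity (ball_int (fun x => \sum_(i < n) partial i (fun y => rcoor i y * f y) x) r).
  rewrite ball_int_sum => [|i]; last exact: (isC_continuous (isC_partial i (Cy i))).
  transitivity (\sum_(i < n) sphere_int (fun x => rcoor i x * (rcoor i x * f x)) r / r);
    last by apply: eq_bigr => i _; rewrite divergence_ball.
  rewrite -mulr_suml -sphere_int_sum//.
  rewrite (@eq_sphere_int _ _ _ (fun x => \sum_(i < n) rcoor i x * (rcoor i x * f x))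
    (fun x => rho2 x * f x)); last first.
    by move=> x _; rewrite /rho2 mulr_suml; apply: eq_bigr => i _; rewrite mulrA expr2.
  rewrite sphere_int_rho2//; move: (sphere_int f r) => a.
  by field; rewrite gt_eqF.
apply: eq_ball_int => x.
rewrite (eq_bigr (fun i => f x + rcoor i x * partial i f x)) => [|i _]; last first.
  rewrite partialM//; last exact: isC_rcoor.
  by rewrite partial_rcoor eqxx mulr1 addrC.
by rewrite big_split/= sumr_const card_ord mulr_natl.
Qed.

Lemma is_derive_inv r : r != 0 -> is_derive r 1 (fun s : R => s^-1) (- r^-2).
Proof.
move=> r0.
rewrite -[- _]mulr1; exact: (@is_deriveV _ id r 1 1 r0 (is_derive_id _ _)).
Qed.

(** By [sphere_int_euler] a sphere integral is a ball integral divided by the radius, so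
    [is_derive_ball_int] differentiates it. *)
Lemma is_derive_sphere_int f r : isC 1 f -> 0 < r ->
  is_derive r 1 (sphere_int f) (((n%:R - 1) * sphere_int f r + sphere_int (euler f) r) / r).
Proof.
move=> Cf r0; have cf := isC_continuous Cf.
have ce : continuous (euler f) by exact: (isC_continuous (isC_euler x0 Cf)).
have rn0 : r != 0 by rewrite gt_eqF.
have ch : continuous (fun x => n%:R * f x + euler f x).
  by apply: continuous_add => //; exact: continuous_scale.
apply: (@near_eq_is_derive _ _ _
    (fun s => ball_int (fun x => n%:R * f x + euler f x) s * s^-1)).
  near=> s; have s0 : 0 < s by near: s; exact: lt_nbhsr.
  by rewrite -sphere_int_euler// mulrAC mulfV ?gt_eqF// mul1r.
have := is_derive_mulf (is_derive_ball_int x0 ch r0) (is_derive_inv rn0).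
move=> H; apply: (is_derive_eq H).
rewrite -sphere_int_euler// sphere_intD//; last exact: continuous_scale.
by rewrite sphere_intZ//; field.
Unshelve. all: by end_near. Qed.

(** The factor is [r ^ (1 - n)], written with natural exponents; it absorbs the [n - 1] of
    [is_derive_sphere_int]. *)
Definition sphere_mean f r : R := r / r ^+ n * sphere_int f r.

Lemma is_derive_sphere_mean f r : isC 1 f -> 0 < r ->
  is_derive r 1 (sphere_mean f) (sphere_mean (euler f) r / r).
Proof.
move=> Cf r0; have rn0 : r != 0 by rewrite gt_eqF.
have rnn0 : r ^+ n != 0 by rewrite expf_neq0.
have dinv : is_derive r 1 (fun s : R => (s ^+ n)^-1)
    (- (r ^+ n)^-2 * (n%:R * r ^+ n.-1)).
  exact: (@is_deriveV _ (fun s : R => s ^+ n) r _ 1 rnn0 (is_derive_expn n r)).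
have nE : n%:R * r ^+ n.-1 = n%:R * r ^+ n / r.
  by case: (n) => [|m]; rewrite ?mul0r//= exprSr mulrA mulfK.
have := is_derive_mulf (is_derive_mulf (is_derive_id r 1) dinv)
  (is_derive_sphere_int Cf r0).
rewrite nE => H; apply: (is_derive_eq H); rewrite /sphere_mean.
move: (sphere_int f r) (sphere_int (euler f) r) (r ^+ n) rnn0 => a b c c0.
by field; rewrite rn0 c0.
Qed.

Lemma sphere_meanD f g r : continuous f -> continuous g ->
  sphere_mean (fun x => f x + g x) r = sphere_mean f r + sphere_mean g r.
Proof. by move=> cf cg; rewrite /sphere_mean sphere_intD// mulrDr. Qed.

Lemma sphere_meanZ c f r : continuous f ->
  sphere_mean (fun x => c * f x) r = c * sphere_mean f r.
Proof. by move=> cf; rewrite /sphere_mean sphere_intZ// mulrCA. Qed.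

Lemma eq_sphere_mean f g r : (forall x, esphere x0 r x -> f x = g x) ->
  sphere_mean f r = sphere_mean g r.
Proof. by move=> fg; rewrite /sphere_mean (eq_sphere_int fg). Qed.

Lemma sphere_mean_ge0 f r : 0 < r -> (forall x, 0 <= f x) -> 0 <= sphere_mean f r.
Proof.
move=> r0 f0; rewrite mulr_ge0//; last by apply: Rintegral_ge0 => x _; exact: f0.
by rewrite divr_ge0 ?exprn_ge0 ?(ltW r0).
Qed.

(** Divergence theorem for the field [f grad g]. *)
Lemma green_first f g r : isC 1 f -> isC 2 g -> 0 < r ->
  ball_int (fun x => grad_dot f g x + f x * laplacian g x) r =
  sphere_int (fun x => f x * euler g x) r / r.
Proof.
move=> Cf Cg r0.
have Cp i : isC 1 (fun x => f x * partial i g x) by apply: isCM => //; exact: isC_partial.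
have cy i : continuous (fun x => rcoor i x * (f x * partial i g x)).
  by apply: continuous_mul; exact: (isC_continuous (isC_rcoor x0 0 i)) ||
     exact: (isC_continuous (Cp i)).
transitivity (ball_int (fun x => \sum_(i < n) partial i (fun y => f y * partial i g y) x) r).
  apply: eq_ball_int => x; rewrite /grad_dot /laplacian mulr_sumr -big_split.
  apply: eq_bigr => i _ /=; rewrite partialM//; last exact: isC_partial.
  by rewrite addrC [partial i g x * _]mulrC.
rewrite ball_int_sum => [|i]; last exact: (isC_continuous (isC_partial i (Cp i))).
transitivity (\sum_(i < n) sphere_int (fun x => rcoor i x * (f x * partial i g x)) r / r).
  by apply: eq_bigr => i _; rewrite divergence_ball.
rewrite -mulr_suml -sphere_int_sum//; congr (_ / _).
apply: eq_sphere_int => x _; rewrite /euler mulr_sumr.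
by apply: eq_bigr => i _; rewrite mulrCA.
Qed.

Lemma grad_dotC f g x : grad_dot f g x = grad_dot g f x.
Proof. by apply: eq_bigr => i _; rewrite mulrC. Qed.

Lemma ball_intB f g r : continuous f -> continuous g ->
  ball_int (fun x => f x - g x) r = ball_int f r - ball_int g r.
Proof.
move=> cf cg; apply: RintegralB; [exact: measurable_eball|
  exact: continuous_integrable_eball..].
Qed.

Lemma sphere_intB f g r : continuous f -> continuous g ->
  sphere_int (fun x => f x - g x) r = sphere_int f r - sphere_int g r.
Proof.
move=> cf cg; apply: RintegralB; [exact: measurable_esphere|
  exact: continuous_integrable_esphere..].
Qed.

Lemma green_second f g r : isC 2 f -> isC 2 g -> 0 < r ->
  ball_int (fun x => f x * laplacian g x - g x * laplacian f x) r =
  sphere_int (fun x => f x * euler g x - g x * euler f x) r / r.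
Proof.
move=> Cf Cg r0; have C1f := isCS Cf; have C1g := isCS Cg.
have cf := isC_continuous Cf; have cg := isC_continuous Cg.
have cflg := continuous_mul cf (isC_continuous (isC_laplacian Cg)).
have cglf := continuous_mul cg (isC_continuous (isC_laplacian Cf)).
have cfeg := continuous_mul cf (isC_continuous (isC_euler x0 C1g)).
have cgef := continuous_mul cg (isC_continuous (isC_euler x0 C1f)).
have E1 := green_first C1f Cg r0; have E2 := green_first C1g Cf r0.
have H1 := ball_intD x0 r (isC_continuous (isC_grad_dot C1f C1g)) cflg.
have H2 := ball_intD x0 r (isC_continuous (isC_grad_dot C1g C1f)) cglf.
have H3 := @eq_ball_int R n x0 _ _ r (grad_dotC g f).
have H4 := ball_intB r cflg cglf.
have H5 := sphere_intB r cfeg cgef.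
(* The integrals are abstracted into real variables, so that only linear algebra remains: the
   symmetric gradient terms cancel. *)
have combine (t1 t2 d d' p1 p2 q1 q2 s4 s5 : R) : t1 = q1 / r -> t2 = q2 / r ->
    t1 = d + p1 -> t2 = d' + p2 -> d' = d -> s4 = p1 - p2 -> s5 = q1 - q2 ->
    s4 = s5 / r 
  by move=> -> -> h1 h2 h3 -> ->; rewrite mulrBl h1 h2 h3; ring.
exact: (combine _ _ _ _ _ _ _ _ _ _ E1 E2 H1 H2 H3 H4 H5).
Qed.

(** Differentiating Green's first identity in the radius gives an identity on the sphere; removing
    its radial parts leaves the tangential Laplacian and the tangential gradients. *)
Lemma sphere_mean_by_parts f g r : isC 1 f -> isC 2 g -> 0 < r ->
  sphere_mean (fun x => f x * tan_laplacian x0 g x) r = - sphere_mean (tan_dot x0 f g) r.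
Proof.
move=> Cf Cg r0; have rn0 : r != 0 by rewrite gt_eqF.
have C1g := isCS Cg; have Ceg := isC_euler x0 Cg.
have Cfe : isC 1 (fun x => f x * euler g x) by exact: isCM.
have cd := isC_continuous (isC_grad_dot Cf C1g).
have cf := isC_continuous Cf.
have clg := isC_continuous (isC_laplacian Cg).
have cef := isC_continuous (isC_euler x0 Cf).
have ceg := isC_continuous Ceg.
have ceeg := isC_continuous (isC_euler x0 Ceg).
have cfl : continuous (fun x => f x * laplacian g x) by exact: continuous_mul.
have ch : continuous (fun x => grad_dot f g x + f x * laplacian g x).
  exact: continuous_add.
have cfe := isC_continuous Cfe.
have ctd : continuous (tan_dot x0 f g) by exact: (isC_continuous (isC_tan_dot x0 Cf C1g)).
have ctl : continuous (fun x => f x * tan_laplacian x0 g x).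
  by apply: continuous_mul => //; exact: (isC_continuous (isC_tan_laplacian x0 Cg)).
have dl := is_derive_ball_int x0 ch r0.
have dr := is_derive_mulf (is_derive_sphere_int Cfe r0) (is_derive_inv rn0).
have E := is_derive_unique_pos r0 (fun s s0 => green_first Cf Cg s0) dl dr.
have E2 : sphere_int (fun x => rho2 x * (grad_dot f g x + f x * laplacian g x)) r =
  (n%:R - 2) * sphere_int (fun x => f x * euler g x) r +
  sphere_int (euler (fun x => f x * euler g x)) r.
  rewrite sphere_int_rho2// E; move: (sphere_int _ r) (sphere_int _ r) => a b.
  by field.
suff : sphere_mean (fun x => f x * tan_laplacian x0 g x + tan_dot x0 f g x) r = 0.
  by rewrite sphere_meanD// => /eqP; rewrite addr_eq0 => /eqP.
rewrite /sphere_mean; apply/eqP; rewrite mulf_eq0; apply/orP; right; apply/eqP.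
(* Pointwise, by the product rule for [L (f L g)]: the terms [L f L g] cancel and those in [f L L g]
   match. *)
have -> : sphere_int (fun x => f x * tan_laplacian x0 g x + tan_dot x0 f g x) r =
  sphere_int (fun x => rho2 x * (grad_dot f g x + f x * laplacian g x)) r +
  - 1 * ((n%:R - 2) * sphere_int (fun x => f x * euler g x) r +
  sphere_int (euler (fun x => f x * euler g x)) r).
  have ce2 : continuous (euler (fun x => f x * euler g x)).
    exact: (isC_continuous (isC_euler x0 Cfe)).
  have crh : continuous (fun x => rho2 x * (grad_dot f g x + f x * laplacian g x)).
    by apply: continuous_mul => //; exact: (isC_continuous (isC_rho2 x0 0)).
  have csum : continuous (fun x => (n%:R - 2) * (f x * euler g x) +
      euler (fun x => f x * euler g x) x).
    by apply: continuous_add => //; exact: continuous_scale.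
  rewrite -sphere_intZ// -sphere_intD//; last exact: continuous_scale.
  rewrite -sphere_intZ// -sphere_intD//; last exact: continuous_scale.
  apply: eq_sphere_int => x _.
  rewrite (eulerM x0 x Cf Ceg) /tan_laplacian /tan_dot.
  move: (f x) (rho2 x) (laplacian g x) (euler g x) (euler (euler g) x) (euler f x) => a b c d e k.
  by move: (grad_dot f g x) => l; ring.
by rewrite E2 mulN1r subrr.
Qed.

End spherical_means.

Arguments continuous_mul {R n f g} _ _ x.

(** * Derivative of the energy *)

Section arithmetic.
Context {R : realType}.
Implicit Types (r p N : R).

Lemma exprz_natB r (k n : nat) : r != 0 -> r ^ (k%:Z - n%:Z) = r ^+ k / r ^+ n.
Proof. by move=> r0; rewrite expfzDr// exprnN. Qed.

(** Scalar algebra behind [energyE], with [p] for [r ^+ n]. The coefficient -3 of [m1] is -2 from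
    the surface term and -1 from the differentiated one; that of [mG] is twice one half. *)
Lemma energy_terms r p N (B1 B2 Ih D1 d1 D2 D3 d2 D4 z4 z3 z2 z1 m1 Lm1 mu m0 mphi
    mG LmG lnr : R) : r != 0 -> p != 0 ->
  z4 = r ^+ 4 / p -> z3 = r ^+ 3 / p -> z2 = r ^+ 2 / p -> z1 = r ^+ 1 / p ->
  Ih = B1 - B2 -> D1 = r^-2 * (m1 * p / r) -> d1 = (Lm1 - 2 * m1) / r ^+ 3 ->
  D2 = (mu + 4 * lnr * m0) * p / r -> D3 = r^-1 * (mphi * p / r) ->
  d2 = mG + LmG -> D4 = r^-2 * (mG * p / r) ->
  z4 * (B1 - B2) - 2 * z3 * D1 + 2^-1 * r ^+ 3 * d1 - 8 * (2 - N) * z1 * D2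
    - 4 * (2 - N) * z2 * D3 + 2^-1 * d2 + 2^-1 * z3 * D4 =
  r ^+ 4 / p * Ih + (-3) * m1 + 2^-1 * Lm1 + 8 * (N - 2) * (mu + 4 * (lnr * m0))
    + 4 * (N - 2) * mphi + mG + 2^-1 * LmG.
Proof.
move=> r0 p0 -> -> -> -> -> -> -> -> -> -> ->.
by field; rewrite r0 p0.
Qed.

(** Every mean has a derivative of the form [m / r], hence the common denominator. [(4 - k) J r]
    comes from the power of [s], and the isolated [M4 r] from the logarithm. *)
Lemma is_derive_energy_terms (J M1 M2 M3 M4 M5 M6 M7 : R -> R) (k : nat)
    (r j m1 m2 m3 m4 m5 m6 m7 : R) : 0 < r ->
  is_derive r 1 J j -> is_derive r 1 M1 (m1 / r) -> is_derive r 1 M2 (m2 / r) ->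
  is_derive r 1 M3 (m3 / r) -> is_derive r 1 M4 (m4 / r) ->
  is_derive r 1 M5 (m5 / r) -> is_derive r 1 M6 (m6 / r) ->
  is_derive r 1 M7 (m7 / r) ->
  is_derive r 1 (fun s => s ^+ 4 / s ^+ k * J s + (-3) * M1 s + 2^-1 * M2 s
      + 8 * (k%:R - 2) * (M3 s + 4 * (ln s * M4 s)) + 4 * (k%:R - 2) * M5 s
      + M6 s + 2^-1 * M7 s)
    ((r ^+ 4 / r ^+ k * (r * j + (4 - k%:R) * J r) - 3 * m1 + 2^-1 * m2
      + 8 * (k%:R - 2) * (m3 + 4 * (M4 r + ln r * m4)) + 4 * (k%:R - 2) * m5
      + m6 + 2^-1 * m7) / r).
Proof.
move=> r0 dJ d1 d2 d3 d4 d5 d6 d7; have rn0 : r != 0 by rewrite gt_eqF.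
have rk0 : r ^+ k != 0 by rewrite expf_neq0.
have dinv : is_derive r 1 (fun s : R => (s ^+ k)^-1)
    (- (r ^+ k)^-2 * (k%:R * r ^+ k.-1)).
  exact: (@is_deriveV _ (fun s : R => s ^+ k) r _ 1 rk0 (is_derive_expn k r)).
have kE : k%:R * r ^+ k.-1 = k%:R * r ^+ k / r.
  by case: (k) => [|m]; rewrite ?mul0r//= exprSr mulrA mulfK.
have dln := is_derive1_ln r0.
have H := is_derive_addf (is_derive_addf (is_derive_addf (is_derive_addf
  (is_derive_addf (is_derive_addf
    (is_derive_mulf (is_derive_mulf (is_derive_expn 4 r) dinv) dJ)
    (is_derive_scalef (-3) d1)) (is_derive_scalef 2^-1 d2))
    (is_derive_scalef (8 * (k%:R - 2)) (is_derive_addf d3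
      (is_derive_scalef 4 (is_derive_mulf dln d4)))))
    (is_derive_scalef (4 * (k%:R - 2)) d5)) d6) (is_derive_scalef 2^-1 d7).
apply: (is_derive_eq H); rewrite kE /=.
move: (J r) (M4 r) (ln r) (r ^+ k) rk0 {H dinv kE dln dJ d1 d2 d3 d4 d5 d6 d7} => a b c d d0.
by field; rewrite rn0 d0.
Qed.

(** The left-hand side contains [- e * (v + 4)]: the constant 4 in [phi] is what turns it into
    [- phi * ll]. *)
Lemma pohozaev_integrand (lu ll llu e phi v lphi Lh lv : R) :
  phi = v + 4 -> ll = e -> Lh = lu * llu - e * v -> lphi = lv ->
  lv = llu + 2 * lu ->
  4 * (2^-1 * (lu * lu) - e) + Lh = lu * lphi - phi * ll.
Proof. by move=> -> -> -> -> ->; field. Qed.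

(** [Tu] and [Tv] are solved for [rho * lu] and [rho * lv], and [v] is replaced by [phi - 4], the
    source of the linear terms. The shape [f + c * g], including the coefficients [1] and [-1], is
    the one that [has_mean_addZ] consumes. *)
Lemma tangential_decomposition (rho lu llu v phi Lv LLv Tu Tv lv N : R) :
  phi = v + 4 -> Tu = rho * lu - (N - 2) * v - Lv ->
  Tv = rho * lv - (N - 2) * Lv - LLv -> lv = llu + 2 * lu ->
  rho * (lu * Lv - phi * llu) =
  Lv * Lv + 1 * (Lv * Tu) + 2 * (phi * Tu) + -1 * (phi * Tv) + 2 * (phi * Lv)
    + -1 * (phi * LLv) + (2 * (N - 2)) * (phi * phi) + (- 4 * (N - 2)) * Lv
    + (- 8 * (N - 2)) * phi.
Proof. by move=> -> -> -> ->; ring. Qed.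

(** The [u + 4 ln r] term of the energy cancels the mean [a6] of [phi], since [a6 = m3 + 4 * M4],
    and the [du/dr + 4/r] term cancels [a5]. What remains of the radial part is
    [2 a1 - 4 a3 + 2 (N - 2) a4]; completing the square in [q] takes 2 from the last coefficient,
    whence [2 (N - 3)]. *)
Lemma energy_derivative_terms (N X m1 m2 m3 M4 m4 m5 m6 m7 lnr a1 a2 a3 a4 a5 a6
    b1 b2 b3 q : R) :
  X = a1 + 1 * - b1 + 2 * - b2 + -1 * - b3 + 2 * a3 + -1 * a2
    + (2 * (N - 2)) * a4 + (- 4 * (N - 2)) * a5 + (- 8 * (N - 2)) * a6 ->
  m1 = 2 * a3 -> m2 = 2 * (a2 + 1 * a1) -> m4 = 0 -> a6 = m3 + 4 * M4 -> m5 = a5 ->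
  m6 = 2 * b2 -> m7 = 2 * (b1 + 1 * b3) -> q = a1 + (-2) * a3 + 1 * a4 ->
  X - 3 * m1 + 2^-1 * m2 + 8 * (N - 2) * (m3 + 4 * (M4 + lnr * m4))
    + 4 * (N - 2) * m5 + m6 + 2^-1 * m7 = 2 * q + 2 * b3 + 2 * (N - 3) * a4.
Proof. by move=> -> -> -> -> -> -> -> -> ->; field. Qed.

Lemma ler_double_sum (q b c : R) : 0 <= q -> 0 <= b -> c <= 2 * q + 2 * b + c.
Proof. by move=> q0 b0; rewrite lerDr addr_ge0// mulr_ge0. Qed.

End arithmetic.

Section sphere_formulas.
Context {R : realType} {n : nat}.
Implicit Types (x : 'rV[R]_n) (f g : 'rV[R]_n -> R) (r s c : R).
Variable x0 : 'rV[R]_n.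
Local Notation sphere_int := (sphere_int x0).
Local Notation sphere_mean := (sphere_mean x0).

(** Continuity travels with the value, so that long linear combinations can be assembled without
    side conditions. *)
Definition has_mean r f a := continuous f /\ sphere_mean f r = a.

Lemma has_meanI r f : continuous f -> has_mean r f (sphere_mean f r).
Proof. by []. Qed.

Lemma has_mean_addZ r c f g a b : has_mean r f a -> has_mean r g b ->
  has_mean r (fun x => f x + c * g x) (a + c * b).
Proof.
move=> [cf <-] [cg <-]; split; first by apply: continuous_add => //; exact: continuous_scale.
by rewrite sphere_meanD ?sphere_meanZ//; exact: continuous_scale.
Qed.

Lemma sphere_int_mean f r : r != 0 ->
  sphere_int f r = sphere_mean f r * r ^+ n / r.
Proof.
move=> r0; rewrite /sphere_mean; move: (sphere_int f r) => a.
by field; rewrite r0 expf_neq0.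
Qed.

Lemma radial_esphere f r x : isC 1 f -> esphere x0 r x ->
  radial x0 f x = euler x0 f x / r.
Proof.
move=> Cf /= xr; rewrite /radial xr.
have [_ ->] := directional_derivative x (r^-1 *: (x - x0)) Cf.
rewrite /euler mulr_suml; apply: eq_bigr => i _.
by rewrite !mxE [RHS]mulrC mulrA.
Qed.

Lemma grad_sqE f x : grad_sq f x = grad_dot f f x.
Proof. by apply: eq_bigr => i _; rewrite expr2. Qed.

Lemma sphere_int_tangential f r : isC 1 f -> 0 < r ->
  sphere_int (fun x => grad_sq f x - `|radial x0 f x| ^+ 2) r =
  r^-2 * sphere_int (tan_dot x0 f f) r.
Proof.
move=> Cf r0; rewrite -sphere_intZ; last first.
  exact: (isC_continuous (isC_tan_dot x0 Cf Cf)).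
apply: eq_sphere_int => x xr.
rewrite (radial_esphere Cf xr) real_normK ?num_real// grad_sqE /tan_dot rho2E.
rewrite xr; move: (grad_dot f f x) (euler x0 f x) => a b.
by field; rewrite gt_eqF.
Qed.

End sphere_formulas.

(** * Energy of a solution of the equation *)

Section monotonicity.
Context {R : realType} {n : nat}.
Variables (u : 'rV[R]_n -> R) (x0 : 'rV[R]_n).
Hypothesis u_C4 : isC 4 u.
Hypothesis u_sol : forall x, laplacian (laplacian u) x = expR (u x).
Implicit Types (x : 'rV[R]_n) (r s : R).
Local Notation sphere_int := (sphere_int x0).
Local Notation sphere_mean := (sphere_mean x0).
Local Notation ball_int := (ball_int x0).
Local Notation euler := (euler x0).
Local Notation tan_dot := (tan_dot x0).
Local Notation N := (n%:R : R).

(* On the sphere of radius [r], [phi = r (du/dr + 4/r)]. *)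
Definition phi x : R := euler u x + 4.

Definition density x : R := 2^-1 * (laplacian u x * laplacian u x) - expR (u x).

Let v := euler u.
Let Lv := euler v.
Let LLv := euler Lv.
Let lu := laplacian u.

Let C3u : isC 3 u. Proof. exact: isC_le u_C4. Qed.
Let C2u : isC 2 u. Proof. exact: isC_le u_C4. Qed.
Let C1u : isC 1 u. Proof. exact: isC_le u_C4. Qed.
Let C3v : isC 3 v. Proof. exact: isC_euler. Qed.
Let C2v : isC 2 v. Proof. exact: isCS. Qed.
Let C1v : isC 1 v. Proof. exact: isCS. Qed.
Let C2Lv : isC 2 Lv. Proof. exact: isC_euler. Qed.
Let C1Lv : isC 1 Lv. Proof. exact: isCS. Qed.
Let C1LLv : isC 1 LLv. Proof. exact: isC_euler. Qed.
Let C2lu : isC 2 lu. Proof. exact: isC_laplacian. Qed.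
Let C1lu : isC 1 lu. Proof. exact: isCS. Qed.
Let C3phi : isC 3 phi. Proof. exact: (isCD C3v (isC_cst 3 4)). Qed.
Let C2phi : isC 2 phi. Proof. exact: isCS. Qed.
Let C1phi : isC 1 phi. Proof. exact: isCS. Qed.
Let C1density : isC 1 density.
Proof.
exact: (isCB (isCM (isC_cst 1 2^-1) (isCM C1lu C1lu)) (isC_expR C1u)).
Qed.

Let partial_phi i : partial i phi = partial i v.
Proof.
rewrite (partialD i C1v (isC_cst 1 4)) partial_cst.
by apply/funext => x; rewrite addr0.
Qed.

Let euler_phi x : euler phi x = Lv x.
Proof. by apply: eq_bigr => i _; rewrite partial_phi. Qed.

Let laplacian_phi x : laplacian phi x = euler lu x + 2 * lu x.
Proof.
rewrite -(laplacian_euler x0 x C3u); apply: eq_bigr => i _; by rewrite partial_phi.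
Qed.

Let tan_dot_phi f x : tan_dot phi f x = tan_dot v f x.
Proof.
have gE : grad_dot phi f x = grad_dot v f x.
  by apply: eq_bigr => i _; rewrite partial_phi.
by rewrite /tan_dot gE euler_phi.
Qed.

Let euler_density x :
  euler density x = lu x * euler lu x - expR (u x) * v x.
Proof.
have C1lu2 := isCM C1lu C1lu.
rewrite (eulerB x0 x (isCM (isC_cst 1 2^-1) C1lu2) (isC_expR C1u)).
rewrite (euler_expR x0 x C1u) (euler_scale x0 2^-1 x C1lu2).
rewrite (eulerM x0 x C1lu C1lu).
have half (a b c : R) : 2^-1 * (a * b + a * b) - c = a * b - c by field.
exact: half.
Qed.

(** By [sphere_int_euler], [r] times the sphere integral of the density is the ball integral of
    [n h + L h]; adding [4 - n] times that of [h] leaves [4 h + L h]. The [4 - n] is produced by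
    differentiating [r ^ (4 - n)]. *)
Let pohozaev r : 0 < r ->
  r * sphere_int density r + (4 - N) * ball_int density r =
  sphere_int (fun x => lu x * euler phi x - phi x * euler lu x) r / r.
Proof.
move=> r0; have cd := isC_continuous C1density.
have ce := isC_continuous (isC_euler x0 C1density).
have E1 := sphere_int_euler x0 C1density r0.
have E2 := ball_intD x0 r (continuous_scale N cd) ce.
have E3 := ball_intZ x0 N r cd.
have E4 := ball_intD x0 r (continuous_scale 4 cd) ce.
have E5 := ball_intZ x0 4 r cd.
have E6 := @green_second R n x0 lu phi r C2lu C2phi r0.
have E7 : ball_int (fun x => 4 * density x + euler density x) r =
    ball_int (fun x => lu x * laplacian phi x - phi x * laplacian lu x) r.
  apply: eq_ball_int => x.
  exact: (pohozaev_integrand (erefl (phi x)) (u_sol x) (euler_density x)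
    (laplacian_phi x) (erefl (euler lu x + 2 * lu x))).
have combine (a b c d e f g : R) : a = b -> b = c + d -> c = N * f ->
    e = g -> e = 4 * f + d -> a + (4 - N) * f = g.
  by move=> -> -> -> <- ->; ring.
rewrite -E6; apply: (combine _ _ _ _ _ _ _ E1 E2 E3 E7).
by rewrite -E5; exact: E4.
Qed.

Let Gam := tan_dot u u.
Let phi2 x := phi x * phi x.

Let C3Gam : isC 3 Gam. Proof. exact: (isC_tan_dot x0 u_C4 u_C4). Qed.
Let C2Gam : isC 2 Gam. Proof. exact: isCS. Qed.
Let C1Gam : isC 1 Gam. Proof. exact: isCS. Qed.
Let C3phi2 : isC 3 phi2. Proof. exact: (isCM C3phi C3phi). Qed.
Let C2phi2 : isC 2 phi2. Proof. exact: isCS. Qed.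
Let C1phi2 : isC 1 phi2. Proof. exact: isCS. Qed.

(* The energy once both derivatives in [r] are carried out. *)
Definition energy_closed s : R :=
  s ^+ 4 / s ^+ n * ball_int density s + (-3) * sphere_mean phi2 s
  + 2^-1 * sphere_mean (euler phi2) s
  + 8 * (N - 2) * (sphere_mean u s + 4 * (ln s * sphere_mean (fun=> 1) s))
  + 4 * (N - 2) * sphere_mean phi s + sphere_mean Gam s
  + 2^-1 * sphere_mean (euler Gam) s.

Let sphere_phi2 s : 0 < s ->
  sphere_int (fun x => (radial x0 u x + 4 / s) ^+ 2) s = s^-2 * sphere_int phi2 s.
Proof.
move=> s0; rewrite -(sphere_intZ x0 (s^-2) s (isC_continuous C1phi2)).
apply: eq_sphere_int => x xs; rewrite (radial_esphere C1u xs) /phi2 /phi.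
by move: (euler u x) => a; field; rewrite gt_eqF.
Qed.

Let sphere_phi s : 0 < s ->
  sphere_int (fun x => radial x0 u x + 4 / s) s = s^-1 * sphere_int phi s.
Proof.
move=> s0; rewrite -(sphere_intZ x0 (s^-1) s (isC_continuous C1phi)).
apply: eq_sphere_int => x xs; rewrite (radial_esphere C1u xs) /phi.
by move: (euler u x) => a; field; rewrite gt_eqF.
Qed.

Let derive_phi2 r : 0 < r ->
  derive1 (fun s : R => s ^ (1 - n%:Z) *
      sphere_int (fun x => (radial x0 u x + 4 / s) ^+ 2) s) r =
  (sphere_mean (euler phi2) r - 2 * sphere_mean phi2 r) / r ^+ 3.
Proof.
move=> r0; have rn0 : r != 0 by rewrite gt_eqF.
have dM := is_derive_sphere_mean x0 C1phi2 r0.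
have dV : is_derive r 1 (fun s : R => (s ^+ 2)^-1) (- (r ^+ 2)^-2 * (2%:R * r ^+ 1)).
  exact: (@is_deriveV _ (fun s : R => s ^+ 2) r _ 1 (expf_neq0 2 rn0) (is_derive_expn 2 r)).
have [_ dE] := is_derive_mulf dV dM.
(* For positive [s], the function differentiated in the energy is [s ^- 2] times the mean of
   [phi2]. *)
rewrite derive1E; transitivity ('D_1 (fun s : R => (s ^+ 2)^-1 * sphere_mean phi2 s) r).
  apply: near_eq_derive; near=> s.
  have s0 : 0 < s by near: s; exact: lt_nbhsr.
  rewrite (sphere_phi2 s0) (exprz_natB 1 n (lt0r_neq0 s0)) /sphere_mean.
  by move: (sphere_int phi2 s) (s ^+ n) => a b; rewrite expr1 mulrCA.
rewrite dE; move: (sphere_mean _ r) (sphere_mean _ r) => a b.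
by field.
Unshelve. all: by end_near. Qed.

Let derive_Gam r : 0 < r ->
  derive1 (fun s : R => s ^ (4 - n%:Z) *
      sphere_int (fun x => grad_sq u x - `|radial x0 u x| ^+ 2) s) r =
  sphere_mean Gam r + sphere_mean (euler Gam) r.
Proof.
move=> r0; have rn0 : r != 0 by rewrite gt_eqF.
have dM := is_derive_sphere_mean x0 C1Gam r0.
have [_ dE] := is_derive_mulf (is_derive_id r 1) dM.
(* For positive [s], the function differentiated in the energy is [s] times the mean of [Gam]. *)
rewrite derive1E; transitivity ('D_1 (fun s : R => s * sphere_mean Gam s) r).
  apply: near_eq_derive; near=> s.
  have s0 : 0 < s by near: s; exact: lt_nbhsr.
  have sn0 := lt0r_neq0 s0.
  rewrite (sphere_int_tangential x0 C1u s0) (exprz_natB 4 n sn0) /sphere_mean.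
  move: (sphere_int _ s) (s ^+ n) (expf_neq0 n sn0) => a b b0.
  by field; rewrite sn0 b0.
rewrite dE; move: (sphere_mean _ r) (sphere_mean _ r) => a b.
by field.
Unshelve. all: by end_near. Qed.

Lemma energyE r : 0 < r -> energy r x0 u = energy_closed r.
Proof.
move=> r0; have rn0 : r != 0 by rewrite gt_eqF.
have rnn0 : r ^+ n != 0 by rewrite expf_neq0.
rewrite /energy /energy_closed.
apply: (energy_terms N rn0 rnn0).
- exact: (exprz_natB 4 n rn0).
- exact: (exprz_natB 3 n rn0).
- exact: (exprz_natB 2 n rn0).
- exact: (exprz_natB 1 n rn0).
- have clu2 := isC_continuous (isCM (isC_cst 1 2^-1) (isCM C1lu C1lu)).
  have ceu := isC_continuous (isC_expR C1u).
  apply: (etrans (ball_intB x0 r clu2 ceu)); congr (_ - _).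
  by apply: eq_ball_int => x; rewrite real_normK ?num_real// expr2.
- by apply: (etrans (sphere_phi2 r0)); rewrite (sphere_int_mean x0 phi2 rn0).
- exact: derive_phi2.
- have c1 : continuous (fun _ : 'rV[R]_n => 1 : R) by exact: (isC_continuous (isC_cst 0 1)).
  have cu := isC_continuous C1u.
  have E : sphere_int (fun x => u x + 4 * ln r) r =
      sphere_int u r + (4 * ln r) * sphere_int (fun=> 1) r.
    rewrite -(sphere_intZ x0 (4 * ln r) r c1) -(sphere_intD x0 r cu (continuous_scale _ c1)).
    by apply: eq_sphere_int => x _; rewrite mulr1.
  apply: (etrans E).
  rewrite (sphere_int_mean x0 u rn0) (sphere_int_mean x0 (fun=> 1) rn0).
  by move: (sphere_mean u r) (sphere_mean _ r) => a b; field.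
- by apply: (etrans (sphere_phi r0)); rewrite (sphere_int_mean x0 phi rn0).
- exact: derive_Gam.
- by apply: (etrans (sphere_int_tangential x0 C1u r0)); rewrite (sphere_int_mean x0 _ rn0).
Qed.

Let euler_phi2E : euler phi2 = fun x => 2 * (phi x * Lv x).
Proof.
apply/funext => x; rewrite (eulerM x0 x C1phi C1phi) euler_phi.
by move: (phi x) (Lv x) => a b; ring.
Qed.

Let C1phiLv : isC 1 (fun x => phi x * Lv x). Proof. exact: (isCM C1phi C1Lv). Qed.

Let euler_euler_phi2 x :
  euler (euler phi2) x = 2 * (phi x * LLv x + 1 * (Lv x * Lv x)).
Proof.
rewrite euler_phi2E (euler_scale x0 2 x C1phiLv) (eulerM x0 x C1phi C1Lv) euler_phi.
by rewrite mul1r.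
Qed.

Let tan_dotC f g x : tan_dot f g x = tan_dot g f x.
Proof. by rewrite /tan_dot grad_dotC [euler f x * _]mulrC. Qed.

Let euler_GamE : euler Gam = fun x => 2 * tan_dot v u x.
Proof.
apply/funext => x; rewrite (euler_tan_dot x0 x C2u C2u) (tan_dotC u).
by rewrite mulr_natl mulr2n.
Qed.

Let C1tvu : isC 1 (tan_dot v u). Proof. exact: (isC_tan_dot x0 C2v C2u). Qed.

Let euler_euler_Gam x :
  euler (euler Gam) x = 2 * (tan_dot Lv u x + 1 * tan_dot v v x).
Proof.
rewrite euler_GamE (euler_scale x0 2 x C1tvu) (euler_tan_dot x0 x C2v C2u).
by rewrite mul1r.
Qed.

(** The factor [r ^+ 2] is moved under the mean as [rho2], so that [tangential_decomposition]
    applies pointwise. *)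
Let pohozaev_mean r : 0 < r ->
  r ^+ 4 / r ^+ n * (r * sphere_int density r + (4 - N) * ball_int density r) =
  sphere_mean (fun x => rho2 x0 x * (lu x * Lv x - phi x * euler lu x)) r.
Proof.
move=> r0; have rn0 : r != 0 by rewrite gt_eqF.
have c1 := continuous_mul (isC_continuous C1lu) (isC_continuous C1Lv).
have c2 := continuous_mul (isC_continuous C1phi) (isC_continuous (isC_euler x0 C1lu)).
have c3 : continuous (fun x => lu x * Lv x - phi x * euler lu x).
  exact: (isC_continuous (isCB (isCM (isCS C1lu) (isCS C1Lv))
    (isCM (isCS C1phi) (isC_euler x0 C1lu)))).
rewrite (pohozaev r0) /sphere_mean (sphere_int_rho2 x0 r c3).
have E : sphere_int (fun x => lu x * euler phi x - phi x * euler lu x) r =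
    sphere_int (fun x => lu x * Lv x - phi x * euler lu x) r.
  by apply: eq_sphere_int => x _; rewrite euler_phi.
rewrite E; move: (sphere_int _ r) (r ^+ n) (expf_neq0 n rn0) => a b b0.
by field; rewrite rn0 b0.
Qed.

(** [D] is [r] times the derivative; the inequality drops the means of [(Lv - phi) ^+ 2] and of
    [tan_dot v v]. *)
Lemma energy_derivative r : 0 < r -> exists2 D,
  is_derive r 1 (fun s => energy s x0 u) (D / r) &
  2 * (N - 3) * sphere_mean phi2 r <= D.
Proof.
move=> r0; have rn0 : r != 0 by rewrite gt_eqF.
have C1one : isC 1 (fun _ : 'rV[R]_n => 1 : R) by exact: isC_cst.
have C1ep : isC 1 (euler phi2) by exact: (isC_euler x0 C2phi2).
have C1eG : isC 1 (euler Gam) by exact: (isC_euler x0 C2Gam).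
have H := is_derive_energy_terms n r0
  (is_derive_ball_int x0 (isC_continuous C1density) r0)
  (is_derive_sphere_mean x0 C1phi2 r0) (is_derive_sphere_mean x0 C1ep r0)
  (is_derive_sphere_mean x0 C1u r0) (is_derive_sphere_mean x0 C1one r0)
  (is_derive_sphere_mean x0 C1phi r0) (is_derive_sphere_mean x0 C1Gam r0)
  (is_derive_sphere_mean x0 C1eG r0).
(* The witness is the numerator in [H], transferred from the closed form to the energy, with which
   it agrees near [r]. *)
eexists.
  apply: near_eq_is_derive H; near=> s.
  have s0 : 0 < s by near: s; exact: lt_nbhsr.
  by rewrite energyE.
have cphi := isC_continuous C1phi; have cLv := isC_continuous C1Lv.
have cLLv := isC_continuous C1LLv; have cv := isC_continuous C1v.
have cone := isC_continuous C1one.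
have cTu : continuous (tan_laplacian x0 u) by exact: (isC_continuous (isC_tan_laplacian x0 C2u)).
have cTv : continuous (tan_laplacian x0 v) by exact: (isC_continuous (isC_tan_laplacian x0 C2v)).
have h1 := has_meanI x0 r (continuous_mul cLv cLv).
have h2 := has_meanI x0 r (continuous_mul cphi cLLv).
have h3 := has_meanI x0 r (continuous_mul cphi cLv).
have h4 := has_meanI x0 r (continuous_mul cphi cphi).
have h5 := has_meanI x0 r cLv.
have h6 := has_meanI x0 r cphi.
have k1 : has_mean x0 r (fun x => Lv x * tan_laplacian x0 u x)
    (- sphere_mean (tan_dot Lv u) r).
  by split; [exact: continuous_mul|exact: sphere_mean_by_parts].
have k2 : has_mean x0 r (fun x => phi x * tan_laplacian x0 u x)
    (- sphere_mean (tan_dot v u) r).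
  split; first exact: continuous_mul.
  have E : sphere_mean (tan_dot phi u) r = sphere_mean (tan_dot v u) r.
    by apply: eq_sphere_mean => x _; exact: tan_dot_phi.
  exact: (etrans (sphere_mean_by_parts x0 C1phi C2u r0) (congr1 -%R E)).
have k3 : has_mean x0 r (fun x => phi x * tan_laplacian x0 v x)
    (- sphere_mean (tan_dot v v) r).
  split; first exact: continuous_mul.
  have E : sphere_mean (tan_dot phi v) r = sphere_mean (tan_dot v v) r.
    by apply: eq_sphere_mean => x _; exact: tan_dot_phi.
  exact: (etrans (sphere_mean_by_parts x0 C1phi C2v r0) (congr1 -%R E)).
have b1 := has_meanI x0 r (isC_continuous (isC_tan_dot x0 C1Lv C1u)).
have b2 := has_meanI x0 r (isC_continuous C1tvu).
have b3 := has_meanI x0 r (isC_continuous (isC_tan_dot x0 C1v C1v)).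
(* The nesting reproduces term by term the right-hand side of [tangential_decomposition], already
   integrated by parts through [k1], [k2] and [k3]. *)
have [_ EX] := has_mean_addZ (- 8 * (N - 2)) (has_mean_addZ (- 4 * (N - 2))
  (has_mean_addZ (2 * (N - 2)) (has_mean_addZ (-1) (has_mean_addZ 2
  (has_mean_addZ (-1) (has_mean_addZ 2 (has_mean_addZ 1 h1 k1) k2) k3) h3) h2) h4) h5) h6.
have {}EX := etrans (pohozaev_mean r0) (etrans (eq_sphere_mean (fun x _ =>
  tangential_decomposition (erefl (phi x)) (erefl (tan_laplacian x0 u x))
   (erefl (tan_laplacian x0 v x)) (laplacian_euler x0 x C3u))) EX).
have E1 : sphere_mean (euler phi2) r = 2 * sphere_mean (fun x => phi x * Lv x) r.
  by rewrite euler_phi2E; exact: (sphere_meanZ x0 2 r h3.1).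
have [h21 E21] := has_mean_addZ 1 h2 h1.
have E2 : sphere_mean (euler (euler phi2)) r =
    2 * (sphere_mean (fun x => phi x * LLv x) r + 1 * sphere_mean (fun x => Lv x * Lv x) r).
  rewrite -E21 -(sphere_meanZ x0 2 r h21); apply: eq_sphere_mean => x _.
  exact: euler_euler_phi2.
have E4 : sphere_mean (euler (fun=> 1)) r = 0.
  have -> : euler (fun=> 1) = fun=> 0 * 1.
    by apply/funext => x; rewrite euler_cst mul0r.
  by rewrite (sphere_meanZ x0 0 r cone) mul0r.
have E6 : sphere_mean phi r = sphere_mean (euler u) r + 4 * sphere_mean (fun=> 1) r.
  have [_ <-] := has_mean_addZ 4 (has_meanI x0 r cv) (has_meanI x0 r cone).
  by apply: eq_sphere_mean => x _; rewrite mulr1.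
have E5 : sphere_mean (euler phi) r = sphere_mean Lv r.
  by apply: eq_sphere_mean => x _; exact: euler_phi.
have EG : sphere_mean (euler Gam) r = 2 * sphere_mean (tan_dot v u) r.
  by rewrite euler_GamE; exact: (sphere_meanZ x0 2 r b2.1).
have [b13 E13] := has_mean_addZ 1 b1 b3.
have EGG : sphere_mean (euler (euler Gam)) r =
    2 * (sphere_mean (tan_dot Lv u) r + 1 * sphere_mean (tan_dot v v) r).
  rewrite -E13 -(sphere_meanZ x0 2 r b13); apply: eq_sphere_mean => x _.
  exact: euler_euler_Gam.
(* Expansion of the mean of [(Lv - phi) ^+ 2]. *)
have [_ Eq] := has_mean_addZ 1 (has_mean_addZ (-2) h1 h3) h4.
rewrite (energy_derivative_terms _ EX E1 E2 E4 E6 E5 EG EGG Eq).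
have Q0 : 0 <= sphere_mean (fun x =>
    Lv x * Lv x + (-2) * (phi x * Lv x) + 1 * (phi x * phi x)) r.
  apply: sphere_mean_ge0 r0 _ => x.
  have square (a b : R) : a * a + (-2) * (b * a) + 1 * (b * b) = (a - b) ^+ 2.
    by ring.
  by rewrite square sqr_ge0.
have B0 := sphere_mean_ge0 x0 r0 (tan_dot_ge0 x0 v).
exact: ler_double_sum Q0 B0.
Unshelve. all: by end_near. Qed.

Lemma sphere_phi2_mean r : 0 < r ->
  2 * (N - 3) * r ^ (2 - n%:Z) *
    sphere_int (fun x => (radial x0 u x + 4 / r) ^+ 2) r =
  2 * (N - 3) * sphere_mean phi2 r / r.
Proof.
move=> r0; have rn0 : r != 0 by rewrite gt_eqF.
rewrite (sphere_phi2 r0) (exprz_natB 2 n rn0) /sphere_mean.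
move: (sphere_int _ r) (r ^+ n) (expf_neq0 n rn0) => a b b0.
by field; rewrite rn0 b0.
Qed.

End monotonicity.

Theorem theorem5p3 (R : realType) (n : nat) (n_gt3 : (3 < n)%N)
    (u : 'rV[R]_n -> R) (u_C4 : isC 4 u)
    (u_sol : forall x : 'rV[R]_n, laplacian (laplacian u) x = expR (u x))
    (x0 : 'rV[R]_n) :
  (forall l1 l2 : R, 0 < l1 -> l1 <= l2 -> energy l1 x0 u <= energy l2 x0 u) /\
  (forall l : R, 0 < l ->
     derivable (fun s : R => energy s x0 u) l 1 /\
     2 * (n%:R - 3) * l ^ (2 - n%:Z) *
       (\int[sphere_measure x0 l]_(x in esphere x0 l)
          (radial x0 u x + 4 / l) ^+ 2)
     <= derive1 (fun s : R => energy s x0 u) l).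
Proof.
have bound l : 0 < l -> derivable (fun s : R => energy s x0 u) l 1 /\
    2 * (n%:R - 3) * l ^ (2 - n%:Z) *
      sphere_int x0 (fun x => (radial x0 u x + 4 / l) ^+ 2) l
    <= derive1 (fun s : R => energy s x0 u) l.
  move=> l0; have [D [dE EE] leD] := energy_derivative x0 u_C4 u_sol l0.
  split; first exact: dE.
  by rewrite derive1E EE (sphere_phi2_mean x0 u_C4 l0) ler_pM2r ?invr_gt0.
split; last exact: bound.
have derivE l : 0 < l -> derivable (fun s : R => energy s x0 u) l 1.
  by move=> l0; have [] := bound l l0.
have pos l : 0 < l -> 0 <= derive1 (fun s : R => energy s x0 u) l.
  move=> l0; have [_] := bound l l0; apply: le_trans.
  (* Here [3 < n] makes the lower bound nonnegative. *)
  rewrite !mulr_ge0//.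
  - by rewrite subr_ge0 ler_nat ltnW.
  - by rewrite exprz_ge0// ltW.
  - by apply: Rintegral_ge0 => x _; exact: sqr_ge0.
move=> l1 l2 l10 l12.
have lpos x : l1 <= x -> 0 < x by exact: lt_le_trans.
apply: (@ger0_derive1_le_cc R (fun s => energy s x0 u) l1 l2) => //.
- by move=> x; rewrite in_itv/= => /andP[/ltW/lpos x0' _]; exact: derivE.
- by move=> x; rewrite in_itv/= => /andP[/ltW/lpos x0' _]; exact: pos.
- apply: derivable_within_continuous => x; rewrite in_itv/= => /andP[/lpos x0' _].
  exact: derivE.
- by rewrite in_itv/= lexx l12.
- by rewrite in_itv/= l12 lexx.
Qed.
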